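(* Let $K$ be a field, let $\mathcal{U}$ be a small $K$-category and let $M:\mathcal{U}\to\mathrm{Mod}(K)$ be a $K$-functor. Let $\Lambda:=\left[\begin{smallmatrix} \mathcal{C}_{K} & 0 \\ \underline{M} & \mathcal{U} \end{smallmatrix}\right]$ be the one-point extension category. Then there exists an equivalence of triangulated categories $$\mathbf{D}_{sg}(\mathrm{Mod}(\Lambda))\simeq\mathbf{D}_{sg}(\mathrm{Mod}(\mathcal{U})).$$
   Context: $K$ is a field. A small $K$-category is a small category whose Hom-sets are $K$-vector spaces with $K$-bilinear composition; a $K$-functor is a functor that is $K$-linear on morphisms. $\mathrm{Mod}(\mathcal{C})$ is the abelian category of covariant $K$-functors $\mathcal{C}\to\mathrm{Mod}(K)$, where $\mathrm{Mod}(K)$ is the category of all $K$-vector spaces. $\mathcal{C}\otimes_K\mathcal{D}$ has objects the pairs $(C,D)$ and morphism spaces $\mathcal{C}(C,C')\otimes_K\mathcal{D}(D,D')$. Triangular matrix category: for $K$-categories $\mathcal{T},\mathcal{U}$ and a $K$-functor $N:\mathcal{T}^{op}\otimes_K\mathcal{U}\to\mathrm{Mod}(K)$, the category $\left[\begin{smallmatrix} \mathcal{T} & 0 \\ N & \mathcal{U} \end{smallmatrix}\right]$ has objects the formal matrices $\left[\begin{smallmatrix} T & 0 \\ N & U \end{smallmatrix}\right]$ with $T\in\mathcal{T}$, $U\in\mathcal{U}$; morphisms from $\left[\begin{smallmatrix} T & 0 \\ N & U \end{smallmatrix}\right]$ to $\left[\begin{smallmatrix} T' & 0 \\ N & U'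 \end{smallmatrix}\right]$ are matrices $\left[\begin{smallmatrix} t & 0 \\ n & u \end{smallmatrix}\right]$ with $t\in\mathcal{T}(T,T')$, $n\in N(T,U')$, $u\in\mathcal{U}(U,U')$; composition is $$\left[\begin{smallmatrix} t_2 & 0 \\ n_2 & u_2 \end{smallmatrix}\right]\circ\left[\begin{smallmatrix} t_1 & 0 \\ n_1 & u_1 \end{smallmatrix}\right]=\left[\begin{smallmatrix} t_2t_1 & 0 \\ n_2\bullet t_1+u_2\bullet n_1 & u_2u_1 \end{smallmatrix}\right],$$ where $n_2\bullet t_1:=N(t_1^{op}\otimes 1)(n_2)$ and $u_2\bullet n_1:=N(1\otimes u_2)(n_1)$. One-point extension category: $\mathcal{C}_K$ is the $K$-category with a single object $\ast$ and $\mathcal{C}_K(\ast,\ast)=K$; $\underline{M}:\mathcal{C}_K^{op}\otimes_K\mathcal{U}\to\mathrm{Mod}(K)$ is the composite of $M$ with the canonical isomorphism $\mathcal{C}_K^{op}\otimes_K\mathcal{U}\cong\mathcal{U}$, so $\underline{M}(\ast,U)=M(U)$; and $\Lambda$ is the triangular matrix category with $\mathcal{T}=\mathcal{C}_K$, $N=\underline{M}$. For an abelian category $\mathcal{A}$ with enough projectives, $\mathrm{Perf}(\mathcal{A})$ is the full subcategory of $\mathbf{D}^{b}(\mathcal{A})$ of complexes isomorphic in $\mathbf{D}^{b}(\mathcal{A})$ to a bounded complex of (arbitrary) projective objects of $\mathcal{A}$, and the singularity category is the Verdier quotient $\mathbf{D}_{sg}(\mathcal{A})=\mathbf{D}^{b}(\mathcal{A})/\mathrm{Perf}(\mathcal{A})$.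 *)

(* Defs.v *)
From Stdlib Require Import Setoid Morphisms.
From HB Require Import structures.
From mathcomp Require Import all_boot all_order all_algebra.
From mathcomp Require Import boolp zify.

Set Implicit Arguments.
Unset Strict Implicit.
Unset Printing Implicit Defensive.

Import GRing.Theory.
Local Open Scope ring_scope.
Local Open Scope quotient_scope.

Section Tensor.
Variable K : fieldType.

Lemma lin_zero (V W : lmodType K) (f : V -> W) : linear f -> f 0 = 0.
Proof.
by move=> hf; have := hf (-1) 0 0; rewrite scaler0 addr0 scaleN1r addNr.
Qed.

Lemma lin_scale (V W : lmodType K) (f : V -> W) :
  linear f -> forall a v, f (a *: v) = a *: f v.
Proof. by move=> hf a v; have := hf a v 0; rewrite (lin_zero hf) !addr0. Qed.

Definition bilin (V W P : lmodType K) (b : V -> W -> P) : Prop :=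
  (forall w, linear (fun v => b v w)) /\ (forall v, linear (b v)).

Section Defs.
Variables V W : lmodType K.

(* A sequence [:: (v1, w1); ...; (vn, wn)] stands for the formal sum of the   *)
(* pure tensors vi (x) wi.                                                    *)
Definition tens_eval (P : lmodType K) (b : V -> W -> P) (s : seq (V * W)) : P :=
  \sum_(p <- s) b p.1 p.2.

(* Two formal sums are identified when no bilinear map separates them; this   *)
(* is the congruence generated by the bilinearity relations.                  *)
Definition tens_rel : rel (seq (V * W)) := fun s t =>
  `[< forall (P : lmodType K) (b : V -> W -> P),
        bilin b -> tens_eval b s = tens_eval b t >].

Lemma tens_rel_refl : reflexive tens_rel.
Proof. by move=> s; apply/asboolP. Qed.

Lemma tens_rel_sym : symmetric tens_rel.
Proof.
by move=> s t; apply/asboolP/asboolP => h P b hb; rewrite h.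
Qed.

Lemma tens_rel_trans : transitive tens_rel.
Proof.
move=> t s u /asboolP h1 /asboolP h2; apply/asboolP => P b hb.
by rewrite h1 // h2.
Qed.

Canonical tens_equiv := EquivRel tens_rel tens_rel_refl tens_rel_sym tens_rel_trans.

Definition tensor := {eq_quot tens_equiv}.
HB.instance Definition _ := Choice.on tensor.
HB.instance Definition _ := EqQuotient.on tensor.

Definition tens_lift (P : lmodType K) (b : V -> W -> P) (t : tensor) : P :=
  tens_eval b (repr t).

Lemma tens_liftE (P : lmodType K) (b : V -> W -> P) s :
  bilin b -> tens_lift b (\pi_tensor s) = tens_eval b s.
Proof.
move=> hb; rewrite /tens_lift; case: piP => s' /eqmodP /asboolP h.
by rewrite [RHS]h.
Qed.

Lemma tensP (t t' : tensor) :
  (forall (P : lmodType K) (b : V -> W -> P),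
     bilin b -> tens_lift b t = tens_lift b t') -> t = t'.
Proof.
move=> h; rewrite -[t]reprK -[t']reprK; apply/eqmodP/asboolP => P b hb.
exact: h.
Qed.

Definition tens_zero : tensor := \pi_tensor [::].
Definition tens_add (t t' : tensor) : tensor := \pi_tensor (repr t ++ repr t').
Definition tens_scale (a : K) (t : tensor) : tensor :=
  \pi_tensor [seq (a *: p.1, p.2) | p <- repr t].
Definition tens_opp (t : tensor) : tensor := tens_scale (-1) t.

Section Lift.
Variables (P : lmodType K) (b : V -> W -> P).
Hypothesis hb : bilin b.

Lemma tens_lift_zero : tens_lift b tens_zero = 0.
Proof. by rewrite tens_liftE // /tens_eval big_nil. Qed.

Lemma tens_lift_add t t' :
  tens_lift b (tens_add t t') = tens_lift b t + tens_lift b t'.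
Proof. by rewrite tens_liftE // /tens_eval big_cat. Qed.

Lemma tens_lift_scale a t : tens_lift b (tens_scale a t) = a *: tens_lift b t.
Proof.
rewrite tens_liftE // /tens_lift /tens_eval big_map scaler_sumr.
by apply: eq_bigr => p _ /=; rewrite (lin_scale (hb.1 p.2)).
Qed.

Lemma tens_lift_opp t : tens_lift b (tens_opp t) = - tens_lift b t.
Proof. by rewrite tens_lift_scale scaleN1r. Qed.
End Lift.

Let liftE := (tens_lift_zero, tens_lift_add, tens_lift_opp, tens_lift_scale).

Lemma tens_addA : associative tens_add.
Proof. by move=> x y z; apply: tensP => P b hb; rewrite !liftE ?addrA. Qed.
Lemma tens_addC : commutative tens_add.
Proof. by move=> x y; apply: tensP => P b hb; rewrite !liftE // addrC. Qed.
Lemma tens_add0 : left_id tens_zero tens_add.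
Proof. by move=> x; apply: tensP => P b hb; rewrite !liftE // add0r. Qed.
Lemma tens_addN : left_inverse tens_zero tens_opp tens_add.
Proof. by move=> x; apply: tensP => P b hb; rewrite !liftE // addNr. Qed.

HB.instance Definition _ :=
  GRing.isZmodule.Build tensor tens_addA tens_addC tens_add0 tens_addN.

Lemma tens_scaleA a a' t : tens_scale a (tens_scale a' t) = tens_scale (a * a') t.
Proof. by apply: tensP => P b hb; rewrite !liftE // scalerA. Qed.
Lemma tens_scale1 : left_id 1 tens_scale.
Proof. by move=> x; apply: tensP => P b hb; rewrite !liftE // scale1r. Qed.
Lemma tens_scaleDr : right_distributive tens_scale +%R.
Proof.
by move=> a x y; apply: tensP => P b hb; rewrite !liftE // -scalerDr.
Qed.
Lemma tens_scaleDl t : {morph tens_scale^~ t : a a' / a + a'}.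
Proof.
by move=> a a'; apply: tensP => P b hb; rewrite !liftE // -scalerDl.
Qed.

HB.instance Definition _ := GRing.Zmodule_isLmodule.Build K tensor
  tens_scaleA tens_scale1 tens_scaleDr tens_scaleDl.

Definition tens (v : V) (w : W) : tensor := \pi_tensor [:: (v, w)].

Lemma tens_lift_tens (P : lmodType K) (b : V -> W -> P) v w :
  bilin b -> tens_lift b (tens v w) = b v w.
Proof. by move=> hb; rewrite tens_liftE // /tens_eval big_seq1. Qed.

Lemma tens_lift_linear (P : lmodType K) (b : V -> W -> P) :
  bilin b -> linear (tens_lift b).
Proof. by move=> hb a t t'; rewrite !liftE. Qed.

Lemma tens_bilin : bilin tens.
Proof.
split=> [w a v v'|v a w w']; apply: tensP => P b hb.
  by rewrite (tens_lift_linear hb) !tens_lift_tens // hb.1.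
by rewrite (tens_lift_linear hb) !tens_lift_tens // hb.2.
Qed.

(* The image of a formal sum under a bilinear map depends linearly on the map.*)
Lemma tens_lift_comb (P : lmodType K) (b b' b'' : V -> W -> P) a t :
  (forall v w, b v w = a *: b' v w + b'' v w) ->
  tens_lift b t = a *: tens_lift b' t + tens_lift b'' t.
Proof.
move=> h; rewrite /tens_lift /tens_eval scaler_sumr -big_split.
by apply: eq_bigr => p _; rewrite h.
Qed.

Lemma tens_ext (P : lmodType K) (f g : tensor -> P) :
  linear f -> linear g -> (forall v w, f (tens v w) = g (tens v w)) -> f =1 g.
Proof.
have key (h : tensor -> P) : linear h -> bilin (fun v w => h (tens v w)) /\
    forall t, h t = tens_lift (fun v w => h (tens v w)) t.
  move=> hl.
  have hbi : bilin (fun v w => h (tens v w)).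
    by split=> [w a v v'|v a w w']; rewrite ?tens_bilin.1 ?tens_bilin.2 hl.
  have h0 : h 0 = 0 by apply: lin_zero.
  split=> // t; rewrite -[t]reprK tens_liftE //.
  elim: (repr t) => [|[v w] s IH]; first by rewrite /tens_eval big_nil.
  rewrite /tens_eval big_cons -[X in _ + X]/(tens_eval (fun v w => h (tens v w)) s) -IH /=.
  rewrite -[h (tens v w)]scale1r -hl; congr h; apply: tensP => Q b hb.
  rewrite (tens_lift_linear hb) scale1r tens_lift_tens // !tens_liftE //.
  by rewrite /tens_eval big_cons.
move=> /key[_ hf] /key[_ hg] h t; rewrite hf hg /tens_lift /tens_eval.
by apply: eq_bigr => p _; rewrite h.
Qed.

End Defs.
End Tensor.
Arguments tens {K V W}.

Record kcat (K : fieldType) := KCat {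
  kobj :> Type;
  khom : kobj -> kobj -> lmodType K;
  kid : forall x, khom x x;
  kcomp : forall x y z, khom y z -> khom x y -> khom x z;
  kcompA : forall x y z w (h : khom z w) (g : khom y z) (f : khom x y),
    kcomp h (kcomp g f) = kcomp (kcomp h g) f;
  kcomp1l : forall x y (f : khom x y), kcomp (kid y) f = f;
  kcomp1r : forall x y (f : khom x y), kcomp f (kid x) = f;
  kcomp_bilin : forall x y z, bilin (@kcomp x y z)
}.
Arguments khom {K} _ _ _.
Arguments kid {K _} _.
Arguments kcomp {K _ x y z} _ _.

Record kfunctor (K : fieldType) (C D : kcat K) := KFunctor {
  kfob :> C -> D;
  kfmap : forall x y, khom C x y -> khom D (kfob x) (kfob y);
  kfmap_lin : forall x y, linear (@kfmap x y);
  kfmap_id : forall x, kfmap (kid x) = kid (kfob x);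
  kfmap_comp : forall x y z (g : khom C y z) (f : khom C x y),
    kfmap (kcomp g f) = kcomp (kfmap g) (kfmap f)
}.
Arguments kfmap {K C D} _ {x y} _.

(* An object of Mod(C): a K-functor from C to the category of all K-vector    *)
(* spaces and linear maps.                                                    *)
Record kmodule (K : fieldType) (C : kcat K) := KModule {
  mob :> C -> lmodType K;
  mact : forall x y, khom C x y -> mob x -> mob y;
  mact_lin : forall x y (f : khom C x y), linear (mact f);
  mact_hom_lin : forall x y (v : mob x), linear (fun f : khom C x y => mact f v);
  mact_id : forall x (v : mob x), mact (kid x) v = v;
  mact_comp : forall x y z (g : khom C y z) (f : khom C x y) (v : mob x),
    mact (kcomp g f) v = mact g (mact f v)
}.
Arguments mact {K C} _ {x y} _ _.

HB.instance Definition _ K (C : kcat K) (F : kmodule C) x y (f : khom C x y) :=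
  GRing.isLinear.Build K (F x) (F y) *:%R (mact F f) (@mact_lin K C F x y f).

Record modhom (K : fieldType) (C : kcat K) (F G : kmodule C) := ModHom {
  mh :> forall x, F x -> G x;
  mh_lin : forall x, linear (mh (x := x));
  mh_nat : forall x y (f : khom C x y) (v : F x),
    mh (mact F f v) = mact G f (mh v)
}.
Arguments mh {K C F G} _ x _.

HB.instance Definition _ K (C : kcat K) (F G : kmodule C) (t : modhom F G) x :=
  GRing.isLinear.Build K (F x) (G x) *:%R (mh t x) (@mh_lin K C F G t x).

Section KCatConstructions.
Variable K : fieldType.
Implicit Types C D : kcat K.

Lemma kop_bilin C (x y z : C) :
  bilin (fun (g : khom C z y) (f : khom C y x) => kcomp f g).
Proof. by split=> [f|g]; [apply: (kcomp_bilin _ _ _).2 | apply: (kcomp_bilin _ _ _).1]. Qed.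

Definition kop C : kcat K := @KCat K C (fun x y => khom C y x) (fun x => kid x)
  (fun x y z g f => kcomp f g)
  (fun x y z w h g f => esym (kcompA f g h))
  (fun x y f => kcomp1r f) (fun x y f => kcomp1l f)
  (fun x y z => kop_bilin x y z).

Section KTensor.
Variables C D : kcat K.
Definition ktens_ob := (C * D)%type.
Definition ktens_hom (x y : ktens_ob) : lmodType K := tensor (khom C x.1 y.1) (khom D x.2 y.2).

(* (c' (x) d') o (c (x) d) = c'c (x) d'd, extended bilinearly.                *)
Definition ktens_comp (x y z : ktens_ob) (g : ktens_hom y z) (f : ktens_hom x y) : ktens_hom x z :=
  tens_lift (fun c' d' =>
    tens_lift (fun c d => tens (kcomp c' c) (kcomp d' d)) f) g.

Lemma ktens_inner_bilin (x y z : ktens_ob) c' d' :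
  bilin (fun (c : khom C x.1 y.1) (d : khom D x.2 y.2) =>
    (tens (kcomp c' c) (kcomp d' d) : ktens_hom x z)).
Proof.
split=> [d a c1 c2|c a d1 d2].
  by rewrite (kcomp_bilin _ _ _).2 (tens_bilin _ _).1.
by rewrite (kcomp_bilin _ _ _).2 (tens_bilin _ _).2.
Qed.

Lemma ktens_outer_bilin (x y z : ktens_ob) (f : ktens_hom x y) :
  bilin (fun (c' : khom C y.1 z.1) (d' : khom D y.2 z.2) =>
    tens_lift (fun c d => (tens (kcomp c' c) (kcomp d' d) : ktens_hom x z)) f).
Proof.
split=> [d' a c1 c2|c' a d1 d2]; apply: tens_lift_comb => c d.
  by rewrite (kcomp_bilin _ _ _).1 (tens_bilin _ _).1.
by rewrite (kcomp_bilin _ _ _).1 (tens_bilin _ _).2.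
Qed.

Lemma ktens_comp_bilin (x y z : ktens_ob) : bilin (@ktens_comp x y z).
Proof.
split=> [f|g a f f'].
  exact: tens_lift_linear (ktens_outer_bilin z f).
apply: tens_lift_comb => c' d'.
exact: (tens_lift_linear (@ktens_inner_bilin x y z c' d')).
Qed.

Lemma ktens_compE (x y z : ktens_ob) (c' : khom C y.1 z.1) (d' : khom D y.2 z.2)
    (c : khom C x.1 y.1) (d : khom D x.2 y.2) :
  ktens_comp (tens c' d' : ktens_hom y z) (tens c d : ktens_hom x y)
  = tens (kcomp c' c) (kcomp d' d).
Proof.
rewrite /ktens_comp tens_lift_tens; last exact: ktens_outer_bilin.
by rewrite tens_lift_tens //; apply: ktens_inner_bilin.
Qed.

Definition ktens_id (x : ktens_ob) : ktens_hom x x := tens (kid x.1) (kid x.2).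

Lemma ktens_comp1l (x y : ktens_ob) (f : ktens_hom x y) : ktens_comp (ktens_id y) f = f.
Proof.
move: f; apply: tens_ext => // [|c d]; first exact: (ktens_comp_bilin _ _ _).2.
by rewrite ktens_compE !kcomp1l.
Qed.

Lemma ktens_comp1r (x y : ktens_ob) (f : ktens_hom x y) : ktens_comp f (ktens_id x) = f.
Proof.
move: f; apply: tens_ext => // [|c d]; first exact: (ktens_comp_bilin _ _ _).1.
by rewrite ktens_compE !kcomp1r.
Qed.

Lemma ktens_compA (x y z w : ktens_ob) (h : ktens_hom z w) (g : ktens_hom y z) (f : ktens_hom x y) :
  ktens_comp h (ktens_comp g f) = ktens_comp (ktens_comp h g) f.
Proof.
have bl := ktens_comp_bilin.
move: h; apply: tens_ext => [a h h'|a h h'|c3 d3]; rewrite ?(bl _ _ _).1 //.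
move: g; apply: tens_ext => [a g g'|a g g'|c2 d2].
- by rewrite (bl _ _ _).1 (bl _ _ _).2.
- by rewrite (bl _ _ _).2 (bl _ _ _).1.
move: f; apply: tens_ext => [a f f'|a f f'|c1 d1]; rewrite ?(bl _ _ _).2 //.
by rewrite !ktens_compE !kcompA.
Qed.

Definition ktens : kcat K := @KCat K ktens_ob ktens_hom ktens_id ktens_comp
  ktens_compA ktens_comp1l ktens_comp1r ktens_comp_bilin.
End KTensor.

Definition mod_precomp C D (N : kmodule D) (F : kfunctor C D) : kmodule C.
Proof.
refine (@KModule K C (fun x => N (F x)) (fun x y f => mact N (kfmap F f)) _ _ _ _).
- by move=> x y f; apply: mact_lin.
- by move=> x y v a f f'; rewrite kfmap_lin mact_hom_lin.
- by move=> x v; rewrite kfmap_id mact_id.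
- by move=> x y z g f v; rewrite kfmap_comp mact_comp.
Defined.

Lemma kone_bilin : bilin (fun b a : K^o => (b * a : K^o)).
Proof.
split=> [w a u v|v a w w'] /=; first by rewrite mulrDl -scalerAl.
by rewrite mulrDr -scalerAr.
Qed.

Definition kone : kcat K := @KCat K unit (fun _ _ => K^o) (fun _ => 1)
  (fun _ _ _ b a => b * a) (fun _ _ _ _ c b a => mulrA c b a)
  (fun _ _ a => mul1r a) (fun _ _ a => mulr1 a) (fun _ _ _ => kone_bilin).

(* The canonical isomorphism C_K^op (x) U -> U, (star, x) |-> x,              *)
(* a (x) u |-> a *: u.                                                        *)
Section KOneTensor.
Variable U : kcat K.

Lemma kone_tens_bilin (x y : U) :
  bilin (fun (a : K^o) (u : khom U x y) => a *: u).
Proof.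
split=> [u a b c|a b u u']; first by rewrite scalerDl scalerA.
by rewrite scalerDr !scalerA mulrC.
Qed.

Definition kone_tens_map (x y : ktens (kop kone) U)
    (f : khom (ktens (kop kone) U) x y) : khom U x.2 y.2 :=
  tens_lift (fun (a : K^o) u => a *: u) f.

Lemma kone_tens_map_lin (x y : ktens (kop kone) U) : linear (@kone_tens_map x y).
Proof. exact: tens_lift_linear (kone_tens_bilin _ _). Qed.

Lemma kone_tens_mapE (x y : ktens (kop kone) U) a u :
  kone_tens_map (tens a u : khom (ktens (kop kone) U) x y) = a *: u.
Proof. by rewrite /kone_tens_map tens_lift_tens //; apply: kone_tens_bilin. Qed.

Lemma kone_tens_map_id x : kone_tens_map (kid x) = kid x.2.
Proof. by rewrite kone_tens_mapE scale1r. Qed.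

Lemma kone_tens_map_comp (x y z : ktens (kop kone) U)
    (g : khom (ktens (kop kone) U) y z) (f : khom (ktens (kop kone) U) x y) :
  kone_tens_map (kcomp g f) = kcomp (kone_tens_map g) (kone_tens_map f).
Proof.
have lin := kone_tens_map_lin; have bl := @kcomp_bilin K.
move: g; apply: tens_ext => [a g g'|a g g'|b v].
- by rewrite (bl (ktens _ _) _ _ _).1 lin.
- by rewrite lin (bl U _ _ _).1.
move: f; apply: tens_ext => [a f f'|a f f'|a u].
- by rewrite (bl (ktens _ _) _ _ _).2 lin.
- by rewrite lin (bl U _ _ _).2.
rewrite [kcomp _ _]ktens_compE !kone_tens_mapE.
rewrite (lin_scale ((bl U _ _ _).2 _)) (lin_scale ((bl U _ _ _).1 _)) scalerA.
by congr (_ *: _).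
Qed.

Definition kone_tens : kfunctor (ktens (kop kone) U) U :=
  @KFunctor K (ktens (kop kone) U) U snd kone_tens_map
    kone_tens_map_lin kone_tens_map_id kone_tens_map_comp.
End KOneTensor.

(* Triangular matrix category: the pair (T, U) is the formal matrix with      *)
(* diagonal T, U, and the triple (t, n, u) the matrix with diagonal t, u and  *)
(* lower left entry n.                                                        *)
Section TriangularMatrix.
Variables (T U : kcat K) (N : kmodule (ktens (kop T) U)).
Definition trimat_ob := (T * U)%type.
Definition trimat_hom (x y : trimat_ob) : lmodType K :=
  (khom T x.1 y.1 * N (x.1, y.2) * khom U x.2 y.2)%type.

Definition tri_actr (x1 y1 : T) (z : U) (n : N (y1, z)) (t : khom T x1 y1) :
    N (x1, z) :=
  @mact _ _ N (y1, z) (x1, z) (tens (t : khom (kop T) y1 x1) (kid z)) n.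

Definition tri_actl (x : T) (y2 z2 : U) (u : khom U y2 z2) (n : N (x, y2)) :
    N (x, z2) :=
  @mact _ _ N (x, y2) (x, z2) (tens (kid x : khom (kop T) x x) u) n.

Definition tri_comp (x y z : trimat_ob) (g : trimat_hom y z) (f : trimat_hom x y) : trimat_hom x z :=
  (kcomp g.1.1 f.1.1, tri_actr g.1.2 f.1.1 + tri_actl g.2 f.1.2, kcomp g.2 f.2).

Definition tri_id (x : trimat_ob) : trimat_hom x x := (kid x.1, 0, kid x.2).

Lemma tri_actr_bilin x1 y1 z : bilin (@tri_actr x1 y1 z).
Proof.
split=> [t a n n'|n a t t'] /=; rewrite /tri_actr; first exact: mact_lin.
by rewrite (tens_bilin _ _).1 mact_hom_lin.
Qed.

Lemma tri_actl_bilin x y2 z2 : bilin (@tri_actl x y2 z2).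
Proof.
split=> [n a u u'|u a n n'] /=; rewrite /tri_actl; last exact: mact_lin.
by rewrite (tens_bilin _ _).2 mact_hom_lin.
Qed.

Lemma tri_actr0 x1 y1 z (t : khom T x1 y1) : tri_actr (0 : N (y1, z)) t = 0.
Proof. exact: linear0. Qed.

Lemma tri_actl0 x y2 z2 (u : khom U y2 z2) : tri_actl u (0 : N (x, y2)) = 0.
Proof. exact: linear0. Qed.

Lemma tri_actrD x1 y1 z (t : khom T x1 y1) (n n' : N (y1, z)) :
  tri_actr (n + n') t = tri_actr n t + tri_actr n' t.
Proof. exact: linearD. Qed.

Lemma tri_actlD x y2 z2 (u : khom U y2 z2) (n n' : N (x, y2)) :
  tri_actl u (n + n') = tri_actl u n + tri_actl u n'.
Proof. exact: linearD. Qed.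

Lemma tri_actr1 x z (n : N (x, z)) : tri_actr n (kid x) = n.
Proof. exact: mact_id. Qed.

Lemma tri_actl1 x z (n : N (x, z)) : tri_actl (kid z) n = n.
Proof. exact: mact_id. Qed.

Lemma tri_actrM x y w z (n : N (w, z)) (t' : khom T y w) (t : khom T x y) :
  tri_actr n (kcomp t' t) = tri_actr (tri_actr n t') t.
Proof.
by rewrite /tri_actr -mact_comp [X in _ = mact N X _]ktens_compE /= kcomp1l.
Qed.

Lemma tri_actlM x y w z (n : N (x, y)) (u' : khom U w z) (u : khom U y w) :
  tri_actl (kcomp u' u) n = tri_actl u' (tri_actl u n).
Proof.
by rewrite /tri_actl -mact_comp [X in _ = mact N X _]ktens_compE /= kcomp1l.
Qed.

Lemma tri_actlr x y w z (n : N (y, w)) (u : khom U w z) (t : khom T x y) :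
  tri_actr (tri_actl u n) t = tri_actl u (tri_actr n t).
Proof.
rewrite /tri_actl /tri_actr -!mact_comp.
rewrite [X in mact N X _ = _]ktens_compE [X in _ = mact N X _]ktens_compE /=.
by rewrite !kcomp1l !kcomp1r.
Qed.

Lemma tri_compA (x y z w : trimat_ob) (h : trimat_hom z w) (g : trimat_hom y z) (f : trimat_hom x y) :
  tri_comp h (tri_comp g f) = tri_comp (tri_comp h g) f.
Proof.
rewrite /tri_comp /= !kcompA tri_actlD tri_actrD tri_actrM tri_actlM tri_actlr.
by rewrite addrA.
Qed.

Lemma tri_comp1l (x y : trimat_ob) (f : trimat_hom x y) : tri_comp (tri_id y) f = f.
Proof.
case: f => [[t n] u]; rewrite /tri_comp /= !kcomp1l tri_actr0 tri_actl1.
by rewrite add0r.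
Qed.

Lemma tri_comp1r (x y : trimat_ob) (f : trimat_hom x y) : tri_comp f (tri_id x) = f.
Proof.
case: f => [[t n] u]; rewrite /tri_comp /= !kcomp1r tri_actl0 tri_actr1.
by rewrite addr0.
Qed.

Lemma tri_comp_bilin (x y z : trimat_ob) : bilin (@tri_comp x y z).
Proof.
have bl := @kcomp_bilin K; have br := tri_actr_bilin; have bl' := tri_actl_bilin.
split=> [[[t n] u] a [[t1 n1] u1] [[t2 n2] u2]
        |[[t n] u] a [[t1 n1] u1] [[t2 n2] u2]]; rewrite /tri_comp /=.
  rewrite !(bl _ _ _ _).1 (br _ _ _).1 (bl' _ _ _).1.
  by congr (_, _, _); rewrite /= scalerDr addrACA.
rewrite !(bl _ _ _ _).2 (br _ _ _).2 (bl' _ _ _).2.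
by congr (_, _, _); rewrite /= scalerDr addrACA.
Qed.

Definition trimat : kcat K := @KCat K trimat_ob trimat_hom tri_id tri_comp
  tri_compA tri_comp1l tri_comp1r tri_comp_bilin.
End TriangularMatrix.

Definition one_point_bimodule (U : kcat K) (M : kmodule U) :
    kmodule (ktens (kop kone) U) := mod_precomp M (kone_tens U).

Definition one_point_extension (U : kcat K) (M : kmodule U) : kcat K :=
  trimat (one_point_bimodule M).

End KCatConstructions.

(* Categories with hom-setoids: equality of morphisms is the relation heq, so *)
(* that quotients of hom-sets require no quotient types.                      *)

Record category := Category {
  obj :> Type;
  mor : obj -> obj -> Type;
  heq : forall X Y, mor X Y -> mor X Y -> Prop;
  idc : forall X, mor X X;
  mcomp : forall X Y Z, mor Y Z -> mor X Y -> mor X Z;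
  heq_refl : forall X Y (f : mor X Y), heq f f;
  heq_sym : forall X Y (f g : mor X Y), heq f g -> heq g f;
  heq_trans : forall X Y (f g h : mor X Y), heq f g -> heq g h -> heq f h;
  mcomp_heq : forall X Y Z (g g' : mor Y Z) (f f' : mor X Y),
    heq g g' -> heq f f' -> heq (mcomp g f) (mcomp g' f');
  mcompA : forall X Y Z W (h : mor Z W) (g : mor Y Z) (f : mor X Y),
    heq (mcomp h (mcomp g f)) (mcomp (mcomp h g) f);
  mcomp1l : forall X Y (f : mor X Y), heq (mcomp (idc Y) f) f;
  mcomp1r : forall X Y (f : mor X Y), heq (mcomp f (idc X)) f
}.
Arguments mor {_} _ _.
Arguments heq {_ X Y} _ _.
Arguments idc {_} _.
Arguments mcomp {_ X Y Z} _ _.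

Notation "f =h g" := (heq f g) (at level 70, no associativity).
Notation "g \oc f" := (mcomp g f) (at level 50, left associativity).

#[export] Hint Resolve heq_refl : core.

#[export] Instance heq_equivalence (C : category) (X Y : C) :
  Equivalence (@heq C X Y).
Proof. split; [exact: heq_refl | exact: heq_sym | exact: heq_trans]. Qed.

#[export] Instance mcomp_proper (C : category) (X Y Z : C) :
  Proper (@heq C Y Z ==> @heq C X Y ==> @heq C X Z) (@mcomp C X Y Z).
Proof. by move=> g g' hg f f' hf; apply: mcomp_heq. Qed.

Definition is_iso (C : category) (X Y : C) (f : mor X Y) : Prop :=
  exists g : mor Y X, g \oc f =h idc X /\ f \oc g =h idc Y.

Definition isomorphic (C : category) (X Y : C) : Prop :=
  exists f : mor X Y, is_iso f.

Definition epi (C : category) (X Y : C) (f : mor X Y) : Prop :=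
  forall (Z : C) (u v : mor Y Z), u \oc f =h v \oc f -> u =h v.

Definition projective (C : category) (P : C) : Prop :=
  forall (X Y : C) (g : mor X Y), epi g ->
  forall f : mor P Y, exists f' : mor P X, g \oc f' =h f.

Record functor (C D : category) := Functor {
  fob :> C -> D;
  fmap : forall X Y, mor X Y -> mor (fob X) (fob Y);
  fmap_heq : forall X Y (f f' : mor X Y), f =h f' -> fmap f =h fmap f';
  fmap_id : forall X, fmap (idc X) =h idc (fob X);
  fmap_comp : forall X Y Z (g : mor Y Z) (f : mor X Y),
    fmap (g \oc f) =h fmap g \oc fmap f
}.
Arguments fmap {C D} _ {X Y} _.

#[export] Instance fmap_proper (C D : category) (F : functor C D) (X Y : C) :
  Proper (@heq C X Y ==> @heq D (F X) (F Y)) (@fmap C D F X Y).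
Proof. by move=> f f' hf; apply: fmap_heq. Qed.

Definition fid (C : category) : functor C C :=
  @Functor C C id (fun _ _ f => f) (fun _ _ _ _ h => h)
    (fun _ => heq_refl _) (fun _ _ _ _ _ => heq_refl _).

Definition fcomp (C D E : category) (G : functor D E) (F : functor C D) :
  functor C E.
Proof.
refine (@Functor C E (fun X => G (F X)) (fun X Y f => fmap G (fmap F f)) _ _ _).
- by move=> X Y f f' e; do 2! apply: fmap_heq.
- move=> X; apply: heq_trans (fmap_id _ _).
  by apply: fmap_heq; apply: fmap_id.
- move=> X Y Z g f; apply: heq_trans (fmap_comp _ _ _).
  by apply: fmap_heq; apply: fmap_comp.
Defined.

Record natiso (C D : category) (F G : functor C D) := NatIso {
  nt :> forall X : C, mor (F X) (G X);
  nt_nat : forall (X Y : C) (f : mor X Y), fmap G f \oc nt X =h nt Y \oc fmap F f;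
  nt_iso : forall X : C, is_iso (nt X)
}.

Definition is_equivalence (C D : category) (F : functor C D) : Prop :=
  exists G : functor D C,
    inhabited (natiso (fcomp G F) (fid C)) /\ inhabited (natiso (fcomp F G) (fid D)).

Lemma iso_id (C : category) (X : C) : is_iso (idc X).
Proof. by exists (idc X); split; apply: mcomp1l. Qed.

Lemma iso_comp (C : category) (X Y Z : C) (g : mor Y Z) (f : mor X Y) :
  is_iso g -> is_iso f -> is_iso (g \oc f).
Proof.
move=> [g' [e1 e2]] [f' [e3 e4]]; exists (f' \oc g'); split.
  by rewrite mcompA -(mcompA f') e1 mcomp1r e3.
by rewrite mcompA -(mcompA g) e4 mcomp1r e2.
Qed.

Lemma iso_fmap (C D : category) (F : functor C D) (X Y : C) (f : mor X Y) :
  is_iso f -> is_iso (fmap F f).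
Proof.
move=> [g [e1 e2]]; exists (fmap F g).
by split; rewrite -fmap_comp ?e1 ?e2 fmap_id.
Qed.

(* The data of a triangulated category: a shift functor, a class of           *)
(* distinguished triangles X -f-> Y -g-> Z -h-> X[1], and the addition of     *)
(* parallel morphisms given by its graph (tsum f g h means f + g = h). The    *)
(* axioms are not recorded: triangle functors only refer to the data.         *)

Definition triangle_class (C : category) (S : functor C C) :=
  forall X Y Z : C, mor X Y -> mor Y Z -> mor Z (S X) -> Prop.

Record tricat := TriCat {
  tcat :> category;
  tshift : functor tcat tcat;
  tsum : forall X Y : tcat, mor X Y -> mor X Y -> mor X Y -> Prop;
  tdist : triangle_class tshift
}.
Arguments tshift : clear implicits.
Arguments tsum {_ X Y} _ _ _.
Arguments tdist {_ X Y Z} _ _ _.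

Record trifunctor (S T : tricat) := TriFunctor {
  tf_fun :> functor S T;
  tf_shift : natiso (fcomp tf_fun (tshift S)) (fcomp (tshift T) tf_fun);
  tf_additive : forall (X Y : S) (f g h : mor X Y),
    tsum f g h -> tsum (fmap tf_fun f) (fmap tf_fun g) (fmap tf_fun h);
  tf_dist : forall (X Y Z : S) (f : mor X Y) (g : mor Y Z)
      (h : mor Z (tshift S X)),
    tdist f g h ->
    tdist (fmap tf_fun f) (fmap tf_fun g) (tf_shift X \oc fmap tf_fun h)
}.

Definition triangulated_equivalent (S T : tricat) : Prop :=
  exists F : trifunctor S T, is_equivalence F.

Definition iso_closure (C : category) (S : functor C C) (P : triangle_class S) :
    triangle_class S :=
  fun X Y Z f g h =>
    exists (X' Y' Z' : C) (f' : mor X' Y') (g' : mor Y' Z') (h' : mor Z' (S X'))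
      (a : mor X' X) (b : mor Y' Y) (c : mor Z' Z),
      [/\ P _ _ _ f' g' h', is_iso a, is_iso b & is_iso c] /\
      [/\ f \oc a =h b \oc f', g \oc b =h c \oc g' & h \oc c =h fmap S a \oc h'].

(* Shifting the first morphism and the cone of a triangle of the class gives  *)
(* the first morphism and the cone of a triangle of the class.                *)
Definition shift_stable (C : category) (S : functor C C) (P Q : triangle_class S) :=
  forall X Y Z (f : mor X Y) (g : mor Y Z) (h : mor Z (S X)), P _ _ _ f g h ->
  exists (g' : mor (S Y) (S Z)) (h' : mor (S Z) (S (S X))),
    Q _ _ _ (fmap S f) g' h'.

Lemma iso_closure_shift (C : category) (S : functor C C) (P : triangle_class S) :
  shift_stable P (iso_closure P) -> shift_stable (iso_closure P) (iso_closure P).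
Proof.
move=> H X Y Z f g h [X0 [Y0 [Z0 [f0 [g0 [h0 [a [b [c]]]]]]]]].
move=> [[Pt ia ib ic] [e1 e2 e3]].
have [g1 [h1 Q]] := H _ _ _ _ _ _ Pt.
have [X2 [Y2 [Z2 [f2 [g2 [h2 [a2 [b2 [c2]]]]]]]]] := Q.
move=> [[Pt2 ia2 ib2 ic2] [e4 e5 e6]].
have [b' [eb1 eb2]] := iso_fmap S ib; have [c' [ec1 ec2]] := iso_fmap S ic.
exists (fmap S c \oc g1 \oc b'), (fmap S (fmap S a) \oc h1 \oc c').
exists X2, Y2, Z2, f2, g2, h2, (fmap S a \oc a2), (fmap S b \oc b2), (fmap S c \oc c2).
split; [split=> //; apply: iso_comp => //; exact: iso_fmap | split].
- by rewrite mcompA -fmap_comp e1 fmap_comp -!mcompA e4.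
- by rewrite -!mcompA (mcompA b') eb1 mcomp1l e5.
- by rewrite -!mcompA (mcompA c') ec1 mcomp1l e6 fmap_comp !mcompA.
Qed.

(* Gabriel-Zisman localization of a category at a class W of morphisms:       *)
(* morphisms are zigzags, modulo the congruence that makes C -> C[W^-1] a     *)
(* functor and s^-1 a two-sided inverse of s for every s in W.                *)

Definition mor_class (C : category) := forall X Y : C, mor X Y -> Prop.

Section Localization.
Variables (C : category) (W : mor_class C).

Inductive zigzag (X : C) : C -> Type :=
| znil : zigzag X X
| zfwd Y Z : mor Y Z -> zigzag X Y -> zigzag X Z
| zbwd Y Z (s : mor Z Y) : W s -> zigzag X Y -> zigzag X Z.

Inductive zeq (X : C) : forall Y, zigzag X Y -> zigzag X Y -> Prop :=
| zeq_refl Y (z : zigzag X Y) : zeq z z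
| zeq_sym Y (z z' : zigzag X Y) : zeq z z' -> zeq z' z
| zeq_trans Y (z z' z'' : zigzag X Y) : zeq z z' -> zeq z' z'' -> zeq z z''
| zeq_fwd Y Z (f f' : mor Y Z) (z z' : zigzag X Y) :
    f =h f' -> zeq z z' -> zeq (zfwd f z) (zfwd f' z')
| zeq_bwd Y Z (s : mor Z Y) (Ws : W s) (z z' : zigzag X Y) :
    zeq z z' -> zeq (zbwd Ws z) (zbwd Ws z')
| zeq_id Y (z : zigzag X Y) : zeq (zfwd (idc Y) z) z
| zeq_comp Y Z T (g : mor Z T) (f : mor Y Z) (z : zigzag X Y) :
    zeq (zfwd g (zfwd f z)) (zfwd (g \oc f) z)
| zeq_bwd_fwd Y Z (s : mor Y Z) (Ws : W s) (z : zigzag X Y) :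
    zeq (zbwd Ws (zfwd s z)) z
| zeq_fwd_bwd Y Z (s : mor Z Y) (Ws : W s) (z : zigzag X Y) :
    zeq (zfwd s (zbwd Ws z)) z.

Fixpoint zcat (X Y Z : C) (w : zigzag Y Z) : zigzag X Y -> zigzag X Z :=
  match w in zigzag _ Z return zigzag X Y -> zigzag X Z with
  | znil => id
  | zfwd _ _ f w' => fun z => zfwd f (zcat w' z)
  | zbwd _ _ _ Ws w' => fun z => zbwd Ws (zcat w' z)
  end.

Lemma zcat_eq (X Y Z : C) (w w' : zigzag Y Z) (z z' : zigzag X Y) :
  zeq w w' -> zeq z z' -> zeq (zcat w z) (zcat w' z').
Proof.
move=> ew ez; apply: (@zeq_trans _ _ _ (zcat w z')).
  elim: w {ew w'} => [|A B f w IH|A B s Ws w IH] //=.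
    by apply: zeq_fwd IH; apply: heq_refl.
  exact: zeq_bwd.
elim: ew => {w w' Z ez z}.
- by move=> *; apply: zeq_refl.
- by move=> *; apply: zeq_sym.
- by move=> A w w' w'' _ h1 _; apply: zeq_trans.
- by move=> *; apply: zeq_fwd.
- by move=> *; apply: zeq_bwd.
- by move=> *; apply: zeq_id.
- by move=> *; apply: zeq_comp.
- by move=> *; apply: zeq_bwd_fwd.
- by move=> *; apply: zeq_fwd_bwd.
Qed.

Lemma zcatA (X Y Z T : C) (u : zigzag Z T) (w : zigzag Y Z) (z : zigzag X Y) :
  zcat u (zcat w z) = zcat (zcat u w) z.
Proof. by elim: u => //= [A B f u ->|A B s Ws u ->]. Qed.

Lemma zcat1r (X Y : C) (w : zigzag X Y) : zcat w (znil X) = w.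
Proof. by elim: w => //= [A B f w ->|A B s Ws w ->]. Qed.

Definition loc : category.
Proof.
refine (@Category C zigzag zeq znil zcat zeq_refl zeq_sym zeq_trans zcat_eq _ _ _).
- by move=> X Y Z T h g f; rewrite zcatA; apply: zeq_refl.
- by move=> X Y f; apply: zeq_refl.
- by move=> X Y f; rewrite zcat1r; apply: zeq_refl.
Defined.

Definition loc_hom (X Y : C) (f : mor X Y) : mor (X : loc) Y := zfwd f (znil X).
Definition loc_inv (X Y : C) (s : mor X Y) (Ws : W s) : mor (Y : loc) X :=
  zbwd Ws (znil Y).

Definition loc_proj : functor C loc.
Proof.
refine (@Functor C loc id loc_hom _ _ _).
- by move=> X Y f f' e; apply: zeq_fwd => //; apply: zeq_refl.
- by move=> X; apply: zeq_id.
- by move=> X Y Z g f; apply: zeq_sym; apply: zeq_comp.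
Defined.
End Localization.

Section LocFunctor.
Variables (C D : category) (W : mor_class C) (V : mor_class D) (F : functor C D).
Hypothesis FW : forall (X Y : C) (s : mor X Y), W s -> V (fmap F s).

Fixpoint zmap (X Y : C) (z : zigzag W X Y) : zigzag V (F X) (F Y) :=
  match z with
  | znil => znil V (F X)
  | zfwd _ _ f z' => zfwd (fmap F f) (zmap z')
  | zbwd _ _ _ Ws z' => zbwd (FW Ws) (zmap z')
  end.

Lemma zmap_eq (X Y : C) (z z' : zigzag W X Y) : zeq z z' -> zeq (zmap z) (zmap z').
Proof.
elim=> {z z' Y} /=.
- by move=> *; apply: zeq_refl.
- by move=> *; apply: zeq_sym.
- by move=> A w w' w'' _ h1 _; apply: zeq_trans.
- by move=> *; apply: zeq_fwd => //; apply: fmap_heq.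
- by move=> *; apply: zeq_bwd.
- move=> Y z; apply: zeq_trans (zeq_id _).
  by apply: zeq_fwd (zeq_refl _); apply: fmap_id.
- move=> Y Z T g f z; apply: zeq_trans (zeq_comp _ _ _) _.
  by apply: zeq_fwd (zeq_refl _); apply: heq_sym; apply: fmap_comp.
- by move=> *; apply: zeq_bwd_fwd.
- by move=> *; apply: zeq_fwd_bwd.
Qed.

Lemma zmap_cat (X Y Z : C) (w : zigzag W Y Z) (z : zigzag W X Y) :
  zmap (zcat w z) = zcat (zmap w) (zmap z).
Proof. by elim: w => //= [A B f w ->|A B s Ws w ->]. Qed.

Definition loc_functor : functor (loc W) (loc V).
Proof.
refine (@Functor (loc W) (loc V) F zmap zmap_eq _ _).
- by move=> X; apply: zeq_refl.
- by move=> X Y Z g f /=; rewrite zmap_cat; apply: zeq_refl.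
Defined.
End LocFunctor.

(* Localization of the data of a triangulated category at a class W stable    *)
(* under shift: sums are computed over a common denominator, and the          *)
(* distinguished triangles are those isomorphic to the image of one.          *)
Section TriLocalization.
Variables (T : tricat) (W : mor_class T).
Hypothesis shiftW : forall (X Y : T) (s : mor X Y), W s -> W (fmap (tshift T) s).

Definition loc_shift : functor (loc W) (loc W) := loc_functor shiftW.

Definition loc_sum (X Y : loc W) (f g h : mor X Y) : Prop :=
  exists (X' : T) (s : mor X' X) (Ws : W s) (a b c : mor X' Y),
    tsum a b c /\
    [/\ f =h loc_hom W a \oc loc_inv Ws,
        g =h loc_hom W b \oc loc_inv Ws
      & h =h loc_hom W c \oc loc_inv Ws].

Inductive loc_image : triangle_class loc_shift :=
| LocImage (X Y Z : T) (f : mor X Y) (g : mor Y Z) (h : mor Z (tshift T X)) :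
    tdist f g h -> @loc_image X Y Z (loc_hom W f) (loc_hom W g) (loc_hom W h).

Definition loc_tricat : tricat :=
  @TriCat (loc W) loc_shift loc_sum (iso_closure loc_image).

Lemma loc_shift_stable :
  shift_stable (@tdist T) (@tdist T) -> shift_stable (@tdist loc_tricat) (@tdist loc_tricat).
Proof.
move=> H; apply: iso_closure_shift => _ _ _ _ _ _ [X Y Z f g h d].
have [g' [h' d']] := H _ _ _ _ _ _ d.
exists (loc_hom W g'), (loc_hom W h').
do 3!eexists; exists (loc_hom W (fmap (tshift T) f)), (loc_hom W g'), (loc_hom W h').
exists (idc _), (idc _), (idc _); split.
  by split; [exact: LocImage | exact: iso_id..].
by split; rewrite ?fmap_id mcomp1l mcomp1r.
Qed.
End TriLocalization.

(* Morphisms completing to a distinguished triangle with third object in N;   *)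
(* inverting them gives the Verdier quotient by N.                            *)
Definition cone_in (T : tricat) (N : T -> Prop) : mor_class T :=
  fun X Y f => exists (Z : T) (g : mor Y Z) (h : mor Z (tshift T X)),
    tdist f g h /\ N Z.

Lemma cone_in_shift (T : tricat) (N : T -> Prop) :
  shift_stable (@tdist T) (@tdist T) -> (forall X, N X -> N (tshift T X)) ->
  forall (X Y : T) (f : mor X Y), cone_in N f -> cone_in N (fmap (tshift T) f).
Proof.
move=> H HN X Y f [Z [g [h [d NZ]]]].
have [g' [h' d']] := H _ _ _ _ _ _ d.
by exists (tshift T Z), g', h'; split=> //; apply: HN.
Qed.

Definition verdier_quotient (T : tricat) (N : T -> Prop)
    (hT : shift_stable (@tdist T) (@tdist T))
    (hN : forall X, N X -> N (tshift T X)) : tricat :=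
  loc_tricat (cone_in_shift hT hN).

Section Modules.
Variables (K : fieldType) (C : kcat K).
Implicit Types F G H : kmodule C.

Definition modhom_id F : modhom F F :=
  @ModHom K C F F (fun x => id) (fun x a u v => erefl) (fun x y f v => erefl).

Definition modhom_comp F G H (t : modhom G H) (s : modhom F G) : modhom F H.
Proof.
refine (@ModHom K C F H (fun x v => t x (s x v)) _ _).
- by move=> x a u v; rewrite !linearP.
- by move=> x y f v; rewrite !mh_nat.
Defined.

Definition modhom_opp F G (t : modhom F G) : modhom F G.
Proof.
refine (@ModHom K C F G (fun x v => - t x v) _ _).
- by move=> x a u v; rewrite linearP opprD scalerN.
- by move=> x y f v; rewrite mh_nat linearN.
Defined.

Definition modhom_add F G (t s : modhom F G) : modhom F G.
Proof.
refine (@ModHom K C F G (fun x v => t x v + s x v) _ _).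
- by move=> x a u v; rewrite !linearP scalerDr addrACA.
- by move=> x y f v; rewrite !mh_nat linearD.
Defined.

Definition modsum F G : kmodule C.
Proof.
refine (@KModule K C (fun x => (F x * G x)%type)
  (fun x y f p => (mact F f p.1, mact G f p.2)) _ _ _ _).
- by move=> x y f a u v; rewrite !linearP.
- by move=> x y v a f g; rewrite !mact_hom_lin.
- by move=> x [u v]; rewrite !mact_id.
- by move=> x y z g f v; rewrite !mact_comp.
Defined.

Definition Mod : category.
Proof.
refine (@Category (kmodule C) (@modhom K C)
  (fun F G t s => forall x, t x =1 s x) modhom_id modhom_comp _ _ _ _ _ _ _) => //.
- by move=> F G t s h x v; rewrite h.
- by move=> F G t s r h h' x v; rewrite h h'.
- by move=> F G H t t' s s' h h' x v /=; rewrite h' h.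
Defined.

Record bcomplex := BComplex {
  cterm :> int -> kmodule C;
  cdiff : forall n, modhom (cterm n) (cterm (n + 1));
  cdiffK : forall n x (v : cterm n x), cdiff (n + 1) x (cdiff n x v) = 0;
  cbounded : exists N : nat, forall n : int, (N < `|n|)%N ->
    forall x (v : cterm n x), v = 0
}.

Implicit Types X Y Z : bcomplex.

Record chmap X Y := ChMap {
  cm :> forall n, modhom (X n) (Y n);
  cm_comm : forall n x (v : X n x), cm (n + 1) x (cdiff X n x v) = cdiff Y n x (cm n x v)
}.

Definition chmap_id X : chmap X X :=
  @ChMap X X (fun n => modhom_id (X n)) (fun n x v => erefl).

Definition chmap_comp X Y Z (g : chmap Y Z) (f : chmap X Y) : chmap X Z.
Proof.
refine (@ChMap X Z (fun n => modhom_comp (g n) (f n)) _).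
by move=> n x v; rewrite /= !cm_comm.
Defined.

Definition chmap_add X Y (f g : chmap X Y) : chmap X Y.
Proof.
refine (@ChMap X Y (fun n => modhom_add (f n) (g n)) _).
by move=> n x v; rewrite /= !cm_comm linearD.
Defined.

(* The homotopy s has components X^(n+1) -> Y^n, and the equation is stated   *)
(* in degree n + 1.                                                           *)
Definition homotopic X Y (f g : chmap X Y) : Prop :=
  exists s : forall n, modhom (X (n + 1)) (Y n),
  forall n x (v : X (n + 1) x),
    f (n + 1) x v - g (n + 1) x v
    = cdiff Y n x (s n x v) + s (n + 1) x (cdiff X (n + 1) x v).

Lemma homotopic_eq X Y (f g : chmap X Y) :
  (forall n x, f n x =1 g n x) -> homotopic f g.
Proof.
move=> h; have z n : modhom (X (n + 1)) (Y n).
  refine (@ModHom K C _ _ (fun x v => 0) _ _).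
    by move=> x a u v; rewrite scaler0 addr0.
  by move=> x y k v; rewrite linear0.
pose s n := modhom_add (z n) (modhom_opp (z n)).
by exists s => n x v; rewrite /= !subrr h subrr linear0 addr0.
Qed.

Lemma homotopic_sym X Y (f g : chmap X Y) : homotopic f g -> homotopic g f.
Proof.
move=> [s h]; exists (fun n => modhom_opp (s n)) => n x v /=.
by rewrite linearN -opprD -h opprB.
Qed.

Lemma homotopic_trans X Y (f g h : chmap X Y) :
  homotopic f g -> homotopic g h -> homotopic f h.
Proof.
move=> [s hs] [t ht]; exists (fun n => modhom_add (s n) (t n)) => n x v /=.
by rewrite linearD addrACA -hs -ht addrA subrK.
Qed.

Lemma homotopic_comp X Y Z (g g' : chmap Y Z) (f f' : chmap X Y) :
  homotopic g g' -> homotopic f f' ->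
  homotopic (chmap_comp g f) (chmap_comp g' f').
Proof.
move=> [t ht] [s hs]; apply: (@homotopic_trans _ _ _ (chmap_comp g f')).
  exists (fun n => modhom_comp (g n) (s n)) => n x v /=.
  by rewrite -linearB hs linearD /= cm_comm.
exists (fun n => modhom_comp (t n) (f' (n + 1))) => n x v /=.
by rewrite ht cm_comm.
Qed.

Definition Kb_cat : category.
Proof.
refine (@Category bcomplex chmap homotopic chmap_id chmap_comp _
  homotopic_sym homotopic_trans homotopic_comp _ _ _).
all: by move=> *; apply: homotopic_eq.
Defined.

(* X[1]^n = X^(n+1) with differential - d.                                    *)
Definition cshift X : bcomplex.
Proof.
refine (@BComplex (fun n => X (n + 1)) (fun n => modhom_opp (cdiff X (n + 1))) _ _).
- by move=> n x v; rewrite /= linearN opprK /= cdiffK.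
- case: (cbounded X) => N h; exists N.+1 => n hn x v; apply: h.
  move: hn; lia.
Defined.

Definition cshift_map X Y (f : chmap X Y) : chmap (cshift X) (cshift Y).
Proof.
refine (@ChMap (cshift X) (cshift Y) (fun n => f (n + 1)) _).
by move=> n x v; rewrite /= linearN /= cm_comm.
Defined.

Definition Kb_shift : functor Kb_cat Kb_cat.
Proof.
refine (@Functor Kb_cat Kb_cat cshift cshift_map _ _ _).
- move=> X Y f g [s h]; exists (fun n => modhom_opp (s (n + 1))) => n x v /=.
  by rewrite h !linearN !opprK.
- by move=> X; apply: homotopic_eq.
- by move=> X Y Z g f; apply: homotopic_eq.
Defined.

(* Cone(f)^n = X^(n+1) + Y^n, d(u, v) = (- du, f u + dv).                     *)
Definition cone_diff X Y (f : chmap X Y) n :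
  modhom (modsum (X (n + 1)) (Y n)) (modsum (X (n + 1 + 1)) (Y (n + 1))).
Proof.
refine (@ModHom K C (modsum (X (n + 1)) (Y n)) (modsum (X (n + 1 + 1)) (Y (n + 1)))
  (fun x p => (- cdiff X (n + 1) x p.1, f (n + 1) x p.1 + cdiff Y n x p.2)) _ _).
- move=> x a u v; congr (_, _).
    by rewrite /= linearP opprD scalerN.
  by rewrite /= !linearP scalerDr addrACA.
- by move=> x y k [u v]; rewrite /= !mh_nat linearN linearD.
Defined.

Definition cone X Y (f : chmap X Y) : bcomplex.
Proof.
refine (@BComplex (fun n => modsum (X (n + 1)) (Y n)) (cone_diff f) _ _).
- move=> n x [u v] /=; rewrite !linearN linearD /= cm_comm !cdiffK.
  by rewrite !oppr0 addr0 addNr.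
- case: (cbounded X) => N h; case: (cbounded Y) => N' h'.
  exists (maxn N.+1 N') => n hn x [u v]; congr (_, _).
    by apply: h; move: hn; lia.
  by apply: h'; move: hn; lia.
Defined.

Definition cone_in_map X Y (f : chmap X Y) : chmap Y (cone f).
Proof.
unshelve refine (@ChMap Y (cone f)
  (fun n => @ModHom K C (Y n) (modsum (X (n + 1)) (Y n)) (fun x v => (0, v)) _ _) _).
- by move=> x a u v; congr (_, _); rewrite /= scaler0 addr0.
- by move=> x y k v; rewrite /= linear0.
- by move=> n x v /=; rewrite !linear0 add0r.
Defined.

Definition cone_out_map X Y (f : chmap X Y) : chmap (cone f) (cshift X).
Proof.
exact: (@ChMap (cone f) (cshift X)
  (fun n => @ModHom K C (modsum (X (n + 1)) (Y n)) (X (n + 1)) (fun x p => p.1)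
     (fun x a u v => erefl) (fun x y k v => erefl))
  (fun n x v => erefl)).
Defined.

Inductive cone_triangle : triangle_class Kb_shift :=
| ConeTriangle X Y (f : chmap X Y) :
    @cone_triangle X Y (cone f) f (cone_in_map f) (cone_out_map f).

Definition Kb : tricat :=
  @TriCat Kb_cat Kb_shift (fun X Y f g h => homotopic (chmap_add f g) h)
    (iso_closure cone_triangle).

(* The isomorphism Cone(f[1]) = Cone(f)[1], (u, v) |-> (- u, v).              *)
Definition sign_hom F G : modhom (modsum F G) (modsum F G).
Proof.
refine (@ModHom K C (modsum F G) (modsum F G) (fun x p => (- p.1, p.2)) _ _).
- by move=> x a u v; congr (_, _); rewrite /= opprD scalerN.
- by move=> x y k [u v]; rewrite /= linearN.
Defined.

Definition cone_shift X Y (f : chmap X Y) :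
  chmap (cone (cshift_map f)) (cshift (cone f)).
Proof.
refine (@ChMap (cone (cshift_map f)) (cshift (cone f))
  (fun n => sign_hom (X (n + 1 + 1)) (Y (n + 1))) _).
by move=> n x [u v]; congr (_, _); rewrite /= ?opprD ?(linearN (cdiff X _ _)) ?(linearN (f _ _)) ?opprK.
Defined.

Definition cone_shift_inv X Y (f : chmap X Y) :
  chmap (cshift (cone f)) (cone (cshift_map f)).
Proof.
refine (@ChMap (cshift (cone f)) (cone (cshift_map f))
  (fun n => sign_hom (X (n + 1 + 1)) (Y (n + 1))) _).
by move=> n x [u v]; congr (_, _); rewrite /= ?opprD ?(linearN (cdiff X _ _)) ?(linearN (f _ _)) ?opprK.
Defined.

Lemma cone_shift_iso X Y (f : chmap X Y) :
  @is_iso Kb_cat (cone (cshift_map f)) (cshift (cone f)) (cone_shift f).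
Proof.
by exists (cone_shift_inv f); split; apply: homotopic_eq => n x [u v] /=; rewrite opprK.
Qed.

Lemma Kb_shift_stable : shift_stable (@tdist Kb) (@tdist Kb).
Proof.
apply: iso_closure_shift => _ _ _ _ _ _ [X Y f].
have [ci [e1 e2]] := cone_shift_iso f.
pose c : @mor Kb_cat (cone (cshift_map f)) (cshift (cone f)) := cone_shift f.
exists (c \oc (cone_in_map (cshift_map f) : @mor Kb_cat _ _)).
exists ((cone_out_map (cshift_map f) : @mor Kb_cat _ _) \oc ci).
do 3!eexists; exists (cshift_map f), (cone_in_map (cshift_map f)),
  (cone_out_map (cshift_map f)), (idc _), (idc _), c.
split; first by split; [exact: ConeTriangle | exact: iso_id.. | exact: cone_shift_iso].
split; rewrite ?fmap_id ?mcomp1l ?mcomp1r //.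
by rewrite -mcompA e1 mcomp1r.
Qed.

(* H^(n+1)(f) is injective and surjective at every object of C, kernels and   *)
(* images of module maps being computed objectwise.                           *)
Definition quasi_iso : mor_class Kb_cat := fun X Y f =>
  forall n x,
    (forall z : X (n + 1) x, cdiff X (n + 1) x z = 0 ->
       (exists w, f (n + 1) x z = cdiff Y n x w) ->
       exists v, z = cdiff X n x v) /\
    (forall w : Y (n + 1) x, cdiff Y (n + 1) x w = 0 ->
       exists (z : X (n + 1) x) (v : Y n x),
         cdiff X (n + 1) x z = 0 /\ w = f (n + 1) x z + cdiff Y n x v).

Lemma quasi_iso_shift (X Y : Kb) (f : mor X Y) :
  quasi_iso f -> quasi_iso (fmap (tshift Kb) f).
Proof.
move=> H n x; have [inj surj] := H (n + 1) x; split.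
  move=> z /= /eqP; rewrite oppr_eq0 => /eqP dz [w e].
  have [|v ->] := inj z dz; first by exists (- w); rewrite linearN.
  by exists (- v); rewrite linearN opprK.
move=> w /= /eqP; rewrite oppr_eq0 => /eqP dw.
have [z [v [dz ->]]] := surj w dw; exists z, (- v).
by rewrite dz oppr0 linearN opprK.
Qed.

Definition Db : tricat := loc_tricat quasi_iso_shift.

Definition Perf (X : Db) : Prop :=
  exists P : bcomplex, (forall n, @projective Mod (P n)) /\ @isomorphic Db X P.

Lemma Perf_shift (X : Db) : Perf X -> Perf (tshift Db X).
Proof.
move=> [P [hP [f hf]]]; exists (cshift P); split; first by move=> n; apply: hP.
by exists (fmap (tshift Db) f); apply: iso_fmap.
Qed.

Definition Dsg : tricat :=
  verdier_quotient (loc_shift_stable (shiftW := quasi_iso_shift) Kb_shift_stable) Perf_shift.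

End Modules.

(* Main.v *)
(* A module over Lambda is a triple (V, F, phi) with V a vector space, F a        *)
(* U-module and phi : V (x) M -> F. The functor extend : N |-> (0, N) is exact    *)
(* and left adjoint to the exact functor (V, F, phi) |-> F, so it preserves       *)
(* projectives and induces D_sg(U) -> D_sg(Lambda). Its inverse is the derived    *)
(* functor of phi |-> Coker phi, realized on complexes as X |-> Cone(phi_X). On   *)
(* a projective module phi is injective with projective cokernel, so this         *)
(* functor preserves perfect complexes; Cone(phi_(0, N)) is N itself. Finally     *)
(* psi : (V, V (x) M, id) -> (V, F, phi) is a map from a projective module, and   *)
(*   extend (Cone(phi_X)) -> Cone(psi_X) <- X                                     *)
(* consists of a quasi-isomorphism and of a map with perfect cone.                *)

From Stdlib Require Import Setoid Morphisms.
From HB Require Import structures.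
From mathcomp Require Import all_boot all_order all_algebra.
From mathcomp Require Import boolp classical_sets.
Require Import Defs.

Set Implicit Arguments.
Unset Strict Implicit.
Unset Printing Implicit Defensive.

Import GRing.Theory.
Local Open Scope ring_scope.

(** * Vector spaces *)

(** In the endomorphisms of an object of the extension, the idempotents (1, 0, 0) and (0, 0, 1)
    split every module [F] into a point part V and a [U]-part, linked by the pairing phi : V (x) M
    -> F. The module (V, V (x) M, id) is projective because linear surjections split over a field
    ([ptcover_projective]). Hence X -> Cone(psi_X) has perfect cone ([cone_in_Perf]), and X becomes
    isomorphic to Cone(psi_X) in the singularity category. Inside Cone(psi_X) the point parts form
    the cone of an identity, which is contractible; what remains is extend Cone(phi_X)
    ([ancone_compare_quasi_iso]). So X is recovered from Cone(phi_X). In the other direction (0, N)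
    has no point part, and Cone(phi_(0, N)) is N ([ancone_extend_iso]).

    Both functors are defined on homotopy categories without resolutions. The functor V (x) M is
    exact by flatness over a field ([tensM_af_exact]); the [U]-part and the extension (0, N) are
    exact objectwise. Quasi-isomorphisms are therefore preserved ([Kb_af_quasi_iso],
    [Kb_ancone_quasi_iso]). Perfect complexes are preserved because [extend_af] and the cokernel of
    phi are left adjoints of exact functors ([extend_projective], [coker_pairing_projective]), and
    because phi is injective on projectives ([pairing_inj]), where its cone is its cokernel
    ([ancone_coker_quasi_iso]). The triangle structure then passes through both localizations by
    [loc_trifunctor], and natural isomorphisms by [Dsg_natiso]. *)

Section Kernel.
Variables (K : fieldType) (V W : lmodType K) (p : {linear V -> W}).

Definition kerpred : {pred V} := [pred v | p v == 0].

Lemma kerpred_closed : submod_closed kerpred.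
Proof.
split=> [|a u v]; rewrite !inE ?linear0 // => /eqP pu /eqP pv.
by rewrite linearP pu pv scaler0 addr0.
Qed.

HB.instance Definition _ := GRing.isSubmodClosed.Build K V kerpred kerpred_closed.

Definition kersp := {v : V | v \in kerpred}.
HB.instance Definition _ := SubType.on kersp.
HB.instance Definition _ := [Choice of kersp by <:].
HB.instance Definition _ := [SubChoice_isSubLmodule of kersp by <:].

Definition inker (v : V) (h : p v = 0) : kersp := Sub v (introT eqP h).

Lemma kerspP (v : kersp) : p (val v) = 0.
Proof. by apply/eqP; exact: (valP v). Qed.

End Kernel.

(** * Complements, generalized inverses and quotients of vector spaces *)

Section LinearSplitting.
Variable K : fieldType.

Definition subspace (V : lmodType K) (N : V -> Prop) :=
  N 0 /\ forall a u v, N u -> N v -> N (a *: u + v).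

(** Zorn's lemma yields a complement of [N], maximal among the subspaces that meet it trivially; [p]
    is the projection onto this complement along [N]. *)
Lemma subspace_projector (V : lmodType K) (N : V -> Prop) : subspace N ->
  exists p : V -> V, [/\ linear p, forall v, N v -> p v = 0 & forall v, N (v - p v)].
Proof.
move=> [N0 NP].
have NB u v : N u -> N v -> N (u - v).
  by move=> hu hv; have := NP (-1) _ _ hv hu; rewrite scaleN1r addrC.
have NZ a v : N v -> N (a *: v) by move=> /(NP a)/(_ N0); rewrite addr0.
(* The union of the empty chain is empty, so 0 is not required to lie in W.   *)
pose P : set (set V) := fun W =>
  (forall a u v, W u -> W v -> W (a *: u + v)) /\ (forall v, W v -> N v -> v = 0).
have [|W [[Wlin WN] Wmax]] := @Zorn_bigcup V P.
  move=> F FP Ftot; split=> [a u v [A FA Au] [B FB Bv]|v [A FA Av]].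
    have [AB|BA] := Ftot _ _ FA FB.
      by exists B => //; apply: (FP _ FB).1 => //; apply: AB.
    by exists A => //; apply: (FP _ FA).1 => //; apply: BA.
  exact: (FP _ FA).2.
pose W0 v := W v \/ v = 0.
have W0lin a u v : W0 u -> W0 v -> W0 (a *: u + v).
  move=> [Wu|->] [Wv|->]; rewrite ?scaler0 ?add0r; [left|left|left|right] => //.
    exact: Wlin.
  have := Wlin (-1) _ _ Wu Wu; rewrite scaleN1r addNr => Wz; exact: Wlin.
have W0N v : W0 v -> N v -> v = 0 by move=> [|//]; exact: WN.
have dec v : exists w, W0 w /\ N (v - w).
  apply: contrapT => hv.
  (* If [v] were outside [W0 + N], the span of [v] and [W0] would still meet [N] trivially, against
     maximality. *)
  pose W' : set V := fun x => exists a w, W0 w /\ x = a *: v + w.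
  apply: (Wmax W').
    split; first by move=> w Ww; exists 0, w; rewrite scale0r add0r; split=> //; left.
    move=> sub; apply: hv; exists v; rewrite subrr; split=> //.
    by left; apply: sub; exists 1, 0; rewrite scale1r addr0; split=> //; right.
  split=> [a _ _ [b [w [hw ->]]] [c [w' [hw' ->]]]|_ [a [w [hw ->]]]].
    exists (a * b + c), (a *: w + w'); split; first exact: W0lin.
    by rewrite scalerDl scalerDr scalerA addrACA.
  have [->|a0] := eqVneq a 0; first by rewrite scale0r add0r; exact: W0N.
  move=> hN; case: hv; exists (- a^-1 *: w); split.
    by have := W0lin (- a^-1) _ _ hw (or_intror (erefl 0)); rewrite addr0.
  have := NZ a^-1 _ hN.
  by rewrite scalerDr scalerA mulVf // scale1r scaleNr opprK.
have [p hp] := choice dec.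
have uniq w w' : W0 w -> W0 w' -> N (w - w') -> w = w'.
  move=> hw hw' h; apply/subr0_eq/W0N => //.
  by have := W0lin (-1) _ _ hw' hw; rewrite scaleN1r addrC.
exists p; split=> [a u v|v Nv|v]; last exact: (hp v).2.
  apply: uniq; [exact: (hp _).1|apply: W0lin; exact: (hp _).1|].
  have h := NB _ _ (NP a _ _ (hp u).2 (hp v).2) (hp (a *: u + v)).2.
  congr N: h; have -> : a *: (u - p u) + (v - p v) = a *: u + v - (a *: p u + p v).
    by rewrite scalerBr opprD addrACA.
  by rewrite opprB [LHS]addrC addrA subrK.
apply: W0N; first exact: (hp v).1.
by have := NB _ _ Nv (hp v).2; rewrite subKr.
Qed.

(** Project [B] onto the image of [d], then take the preimage lying in a complement of the kernel.
    Such a generalized inverse turns exactness into linear identities, which survive tensoring. *)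
Lemma linear_ginv (A B : lmodType K) (d : A -> B) : linear d ->
  exists s : B -> A, linear s /\ forall a, d (s (d a)) = d a.
Proof.
move=> dl; pose f : {linear A -> B} := HB.pack d (GRing.isLinear.Build _ _ _ _ d dl).
have [|p [pl p0 pN]] := @subspace_projector A (fun a => f a = 0).
  by split=> [|a u v hu hv]; rewrite ?linear0 // linearP hu hv scaler0 addr0.
have [|q [ql q0 qN]] := @subspace_projector B (fun b => exists a, f a = b).
  split; first by exists 0; rewrite linear0.
  by move=> a _ _ [u <-] [v <-]; exists (a *: u + v); rewrite linearP.
have fp a : f (p a) = f a.
  by have := pN a; rewrite linearB => /subr0_eq.
have [r hr] := choice qN.
pose g : {linear A -> A} := HB.pack p (GRing.isLinear.Build _ _ _ _ p pl).
have uniq a a' : f a = f a' -> p a = p a'.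
  move=> e; apply/subr0_eq; rewrite -[p a - p a']/(g a - g a') -linearB.
  by apply: p0; rewrite linearB e subrr.
(* The chosen preimages [r] need not depend linearly on [b]; [p] removes the ambiguity in the kernel
   and makes the composite linear. *)
exists (fun b => p (r b)); split=> [a u v|a].
  rewrite -pl; apply: uniq; rewrite linearP !hr ql scalerBr.
  by rewrite opprD addrACA.
by rewrite -[LHS]/(f (p (r (f a)))) fp hr q0 ?subr0 //; exists a.
Qed.

Lemma linear_section (A B : lmodType K) (d : A -> B) : linear d ->
  (forall b, exists a, d a = b) -> exists s : B -> A, linear s /\ cancel s d.
Proof.
move=> dl ds; have [s [sl sE]] := linear_ginv dl; exists s; split=> // b.
by have [a <-] := ds b.
Qed.

(** The quotient by [N] is realized as the complement onto which [p] projects, cut out as the kernel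
    of [v - p v]. *)
Lemma quotient_space (V : lmodType K) (N : V -> Prop) : subspace N ->
  exists (Q : lmodType K) (q : V -> Q),
    [/\ linear q, forall x, exists v, q v = x & forall v, q v = 0 <-> N v].
Proof.
move=> hN; have [p [pl p0 pN]] := subspace_projector hN.
have [N0 NP] := hN.
pose f v := v - p v.
have fl : linear f.
  by move=> a u v; rewrite /f pl scalerBr opprD addrACA.
pose g : {linear V -> V} := HB.pack f (GRing.isLinear.Build _ _ _ _ f fl).
have gp v : g (p v) = 0.
  have := p0 _ (pN v); rewrite -scaleN1r addrC pl scaleN1r addrC => e.
  by rewrite /= /f; apply/eqP; rewrite subr_eq0 eq_sym -subr_eq0 -opprB oppr_eq0; apply/eqP.
exists (kersp g), (fun v => inker (gp v)); split=> [a u v|x|v].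
- by apply: val_inj; rewrite /= pl.
- by exists (val x); apply: val_inj; apply/esym/subr0_eq; exact: (kerspP x).
split=> [/(congr1 val) /= e|Nv]; first by have := pN v; rewrite e subr0.
by apply: val_inj; rewrite /= p0.
Qed.

End LinearSplitting.

(** * Tensor products of linear maps, and flatness over a field *)

Section TensorMap.
Variable K : fieldType.
Implicit Types V W : lmodType K.

Lemma bilin_comp V W V' W' (P : lmodType K) (b : V' -> W' -> P)
    (f : {linear V -> V'}) (g : {linear W -> W'}) :
  bilin b -> bilin (fun v w => b (f v) (g w)).
Proof. by move=> hb; split=> [w a v v'|v a w w']; rewrite linearP ?hb.1 ?hb.2. Qed.

Definition tens_map V W V' W' (f : {linear V -> V'}) (g : {linear W -> W'}) :
  tensor V W -> tensor V' W' := tens_lift (fun v w => tens (f v) (g w)).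

Lemma tens_map_linear V W V' W' (f : {linear V -> V'}) (g : {linear W -> W'}) :
  linear (tens_map f g).
Proof. exact: tens_lift_linear (bilin_comp _ _ (tens_bilin _ _)). Qed.

HB.instance Definition _ V W V' W' (f : {linear V -> V'}) (g : {linear W -> W'}) :=
  GRing.isLinear.Build K (tensor V W) (tensor V' W') *:%R (tens_map f g)
    (tens_map_linear f g).

Lemma tens_mapE V W V' W' (f : {linear V -> V'}) (g : {linear W -> W'}) v w :
  tens_map f g (tens v w) = tens (f v) (g w).
Proof. exact: tens_lift_tens (bilin_comp _ _ (tens_bilin _ _)). Qed.

Lemma tens_linear_ext V W (P : lmodType K) (f g : {linear tensor V W -> P}) :
  (forall v w, f (tens v w) = g (tens v w)) -> f =1 g.
Proof. by apply: tens_ext => a u v; rewrite linearP. Qed.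

Lemma tens_map_id V W (f : {linear V -> V}) (g : {linear W -> W}) :
  (forall v, f v = v) -> (forall w, g w = w) -> forall t, tens_map f g t = t.
Proof.
move=> hf hg; apply: (@tens_linear_ext _ _ _ (tens_map f g) idfun) => v w /=.
by rewrite tens_mapE hf hg.
Qed.

Lemma tens_map_comp V W V' W' V'' W'' (f' : {linear V' -> V''}) (f : {linear V -> V'})
    (g' : {linear W' -> W''}) (g : {linear W -> W'}) (h : {linear V -> V''})
    (k : {linear W -> W''}) :
  (forall v, f' (f v) = h v) -> (forall w, g' (g w) = k w) ->
  forall t, tens_map f' g' (tens_map f g t) = tens_map h k t.
Proof.
move=> hh hk.
apply: (@tens_linear_ext _ _ _ (tens_map f' g' \o tens_map f g) (tens_map h k)) => v w /=.
by rewrite !tens_mapE hh hk.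
Qed.

Lemma tens_map_combl V W V' W' (f f1 f2 : {linear V -> V'}) (g : {linear W -> W'}) a :
  (forall v, f v = a *: f1 v + f2 v) ->
  forall t, tens_map f g t = a *: tens_map f1 g t + tens_map f2 g t.
Proof.
by move=> h t; apply: tens_lift_comb => v w; rewrite h (tens_bilin _ _).1.
Qed.

Lemma tens_map_combr V W V' W' (f : {linear V -> V'}) (g g1 g2 : {linear W -> W'}) a :
  (forall w, g w = a *: g1 w + g2 w) ->
  forall t, tens_map f g t = a *: tens_map f g1 t + tens_map f g2 t.
Proof.
by move=> h t; apply: tens_lift_comb => v w; rewrite h (tens_bilin _ _).2.
Qed.

(* Flatness over a field: an exact sequence has a linear contracting homotopy,   *)
(* which survives tensoring.                                                    *)
Lemma tens_map_exact V1 V2 V3 W (f : {linear V1 -> V2}) (g : {linear V2 -> V3}) :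
  (forall v, g v = 0 -> exists u, v = f u) ->
  forall t, tens_map g (idfun : {linear W -> W}) t = 0 ->
    exists s, t = tens_map f (idfun : {linear W -> W}) s.
Proof.
move=> ex t gt.
have [s [sl sE]] := linear_ginv (linearP f).
have [r [rl rE]] := linear_ginv (linearP g).
pose s' : {linear V2 -> V1} := HB.pack s (GRing.isLinear.Build _ _ _ _ s sl).
pose r' : {linear V3 -> V2} := HB.pack r (GRing.isLinear.Build _ _ _ _ r rl).
have dec v : v = f (s' v - s' (r' (g v))) + r' (g v).
  have [|u hu] := ex (v - r (g v)); first by rewrite linearB /= rE subrr.
  by rewrite -linearB /= hu sE -hu subrK.
pose k := [the {linear V2 -> V1} of s' \- (s' \o r' \o g)].
have {}dec x : x = tens_map f (idfun : {linear W -> W}) (tens_map k idfun x)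
    + tens_map r' idfun (tens_map g (idfun : {linear W -> W}) x).
  rewrite (tens_map_comp (h := f \o k) (k := idfun)) //.
  rewrite (tens_map_comp (h := r' \o g) (k := idfun)) //.
  rewrite -[tens_map (f \o k) _ x]scale1r.
  rewrite -(@tens_map_combl _ _ _ _ idfun) ?tens_map_id // => v /=.
  by rewrite scale1r -dec.
exists (tens_map k idfun t).
by rewrite {1}[t]dec gt linear0 addr0.
Qed.

End TensorMap.

(** * Localizations *)

Lemma isomorphic_trans (C : category) (X Y Z : C) :
  isomorphic X Y -> isomorphic Y Z -> isomorphic X Z.
Proof. by move=> [f hf] [g hg]; exists (g \oc f); apply: iso_comp. Qed.

Section LocFacts.
Variables (C : category) (W : mor_class C).

Lemma loc_hom_heq (X Y : C) (f g : mor X Y) : f =h g -> loc_hom W f =h loc_hom W g.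
Proof. exact: (fmap_heq (loc_proj W)). Qed.

Lemma loc_hom_comp (X Y Z : C) (g : mor Y Z) (f : mor X Y) :
  loc_hom W (g \oc f) =h loc_hom W g \oc loc_hom W f.
Proof. exact: (fmap_comp (loc_proj W)). Qed.

Lemma loc_hom_inv (X Y : C) (s : mor X Y) (Ws : W s) :
  loc_hom W s \oc loc_inv Ws =h idc _.
Proof. exact: zeq_fwd_bwd. Qed.

Lemma loc_inv_hom (X Y : C) (s : mor X Y) (Ws : W s) :
  loc_inv Ws \oc loc_hom W s =h idc _.
Proof. exact: zeq_bwd_fwd. Qed.

Lemma loc_hom_iso (X Y : C) (s : mor X Y) : W s -> is_iso (loc_hom W s).
Proof.
move=> Ws; exists (loc_inv Ws).
by split; [exact: loc_inv_hom | exact: loc_hom_inv].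
Qed.

(** A zigzag is built from morphisms of [C] and formal inverses; a naturality square for [s] gives
    one for its inverse by composing with the inverse on both sides. *)
Lemma loc_nat (D : category) (F G : functor (loc W) D)
    (t : forall X : C, mor (F X) (G X)) :
  (forall (X Y : C) (f : mor X Y),
     fmap G (loc_hom W f) \oc t X =h t Y \oc fmap F (loc_hom W f)) ->
  forall (X Y : loc W) (f : mor X Y), fmap G f \oc t X =h t Y \oc fmap F f.
Proof.
move=> nat X Y; elim=> {Y} [|Y Z f z IH|Y Z s Ws z IH].
- by rewrite (fmap_id F) (fmap_id G) mcomp1l mcomp1r.
- rewrite (fmap_comp G (loc_hom W f) z) (fmap_comp F (loc_hom W f) z).
  by rewrite -mcompA IH mcompA nat mcompA.
rewrite (fmap_comp G (loc_inv Ws) z) (fmap_comp F (loc_inv Ws) z).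
rewrite -mcompA IH mcompA [X in _ =h X]mcompA.
apply: mcomp_heq => //.
have e := nat _ _ s.
rewrite -[X in X =h _]mcomp1r -(fmap_id F) -(loc_hom_inv Ws) fmap_comp.
rewrite mcompA -(mcompA (fmap G (loc_inv Ws))) -e.
by rewrite mcompA -fmap_comp loc_inv_hom fmap_id mcomp1l.
Qed.

End LocFacts.

Lemma iso_closure_trans (C : category) (S : functor C C) (P : triangle_class S)
    (X Y Z : C) (f : mor X Y) (g : mor Y Z) (h : mor Z (S X)) :
  iso_closure (iso_closure P) f g h -> iso_closure P f g h.
Proof.
move=> [X1 [Y1 [Z1 [f1 [g1 [h1 [a [b [c [[H ia ib ic] [e1 e2 e3]]]]]]]]]]].
have [X2 [Y2 [Z2 [f2 [g2 [h2 [a' [b' [c' [[Q ia' ib' ic'] [e4 e5 e6]]]]]]]]]]] := H.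
exists X2, Y2, Z2, f2, g2, h2, (a \oc a'), (b \oc b'), (c \oc c').
split; first by split=> //; apply: iso_comp.
split.
- by rewrite mcompA e1 -mcompA e4 mcompA.
- by rewrite mcompA e2 -mcompA e5 mcompA.
- by rewrite mcompA e3 -mcompA e6 mcompA -fmap_comp.
Qed.

Lemma iso_closure_incl (C : category) (S : functor C C) (P : triangle_class S)
    (X Y Z : C) (f : mor X Y) (g : mor Y Z) (h : mor Z (S X)) :
  P X Y Z f g h -> iso_closure P f g h.
Proof.
move=> H; exists X, Y, Z, f, g, h, (idc _), (idc _), (idc _).
split; first by split=> //; apply: iso_id.
by split; rewrite ?fmap_id ?mcomp1l ?mcomp1r.
Qed.

Lemma iso_closure_heq (C : category) (S : functor C C) (P : triangle_class S)
    (X Y Z : C) (f f' : mor X Y) (g g' : mor Y Z) (h h' : mor Z (S X)) :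
  P X Y Z f g h -> f =h f' -> g =h g' -> h =h h' -> iso_closure P f' g' h'.
Proof.
move=> H e1 e2 e3; exists X, Y, Z, f, g, h, (idc _), (idc _), (idc _).
split; first by split=> //; apply: iso_id.
by split; rewrite ?fmap_id ?mcomp1l ?mcomp1r // -?e1 -?e2 -?e3.
Qed.

Lemma iso_closure_precomp (C : category) (S : functor C C) (P : triangle_class S)
    (X X' Y Z : C) (f : mor X Y) (g : mor Y Z) (h : mor Z (S X))
    (e : mor X' X) (e' : mor X X') :
  P X Y Z f g h -> e \oc e' =h idc _ -> e' \oc e =h idc _ ->
  iso_closure P (f \oc e) g (fmap S e' \oc h).
Proof.
move=> H e1 e2; exists X, Y, Z, f, g, h, e', (idc _), (idc _).
split; first by split=> //; [exists e | exact: iso_id..].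
by split; rewrite ?mcomp1l ?mcomp1r // -mcompA e1 mcomp1r.
Qed.

(** A functor preserves isomorphisms of triangles, so it is enough to test generating triangles:
    cone triangles in [Kb], images of triangles in a localization. *)
Lemma iso_closure_functor (C D : category) (S : functor C C) (T : functor D D)
    (F : functor C D) (s : natiso (fcomp F S) (fcomp T F))
    (P : triangle_class S) (Q : triangle_class T) :
  (forall (X Y Z : C) (f : mor X Y) (g : mor Y Z) (h : mor Z (S X)), P _ _ _ f g h ->
     iso_closure Q (fmap F f) (fmap F g) (s X \oc fmap F h)) ->
  forall (X Y Z : C) (f : mor X Y) (g : mor Y Z) (h : mor Z (S X)), iso_closure P f g h ->
     iso_closure Q (fmap F f) (fmap F g) (s X \oc fmap F h).
Proof.
move=> PQ X Y Z f g h [X1 [Y1 [Z1 [f1 [g1 [h1 [a [b [c [[H ia ib ic] [e1 e2 e3]]]]]]]]]]].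
apply: iso_closure_trans.
exists (F X1), (F Y1), (F Z1), (fmap F f1), (fmap F g1), (s X1 \oc fmap F h1).
exists (fmap F a), (fmap F b), (fmap F c).
split; first by split; [exact: PQ | exact: iso_fmap..].
split; rewrite -?fmap_comp ?e1 ?e2 //.
rewrite -mcompA -fmap_comp e3 fmap_comp !mcompA.
by apply: mcomp_heq => //; apply: heq_sym; exact: (nt_nat s a).
Qed.

(** * Triangle functors induced on localizations *)

Section LocTriFunctor.
Variables (S T : tricat) (W : mor_class S) (V : mor_class T).
Hypothesis shiftW : forall (X Y : S) (s : mor X Y), W s -> W (fmap (tshift S) s).
Hypothesis shiftV : forall (X Y : T) (s : mor X Y), V s -> V (fmap (tshift T) s).
Variable F : trifunctor S T.
Hypothesis FW : forall (X Y : S) (s : mor X Y), W s -> V (fmap F s).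

Definition loc_tf_shift :
  natiso (fcomp (loc_functor FW) (tshift (loc_tricat shiftW)))
         (fcomp (tshift (loc_tricat shiftV)) (loc_functor FW)).
Proof.
refine (@NatIso (loc W) (loc V)
  (fcomp (loc_functor FW) (tshift (loc_tricat shiftW)))
  (fcomp (tshift (loc_tricat shiftV)) (loc_functor FW))
  (fun X => loc_hom V (tf_shift F X)) _ _).
- apply: loc_nat => X Y f.
  apply: heq_trans (heq_trans (heq_sym (loc_hom_comp _ _ _)) _) (loc_hom_comp _ _ _).
  by apply: loc_hom_heq; exact: (nt_nat (tf_shift F) f).
- move=> X; exact: (iso_fmap (loc_proj V) (nt_iso (tf_shift F) X)).
Defined.

Definition loc_trifunctor : trifunctor (loc_tricat shiftW) (loc_tricat shiftV).
Proof.
refine (@TriFunctor (loc_tricat shiftW) (loc_tricat shiftV) (loc_functor FW)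
  loc_tf_shift _ _).
- move=> X Y f g h [X' [s [Ws [a [b [c [abc [ef eg eh]]]]]]]].
  exists (F X'), (fmap F s), (FW Ws), (fmap F a), (fmap F b), (fmap F c).
  split; first exact: tf_additive.
  by split; [rewrite ef | rewrite eg | rewrite eh]; rewrite fmap_comp.
- apply: iso_closure_functor => _ _ _ _ _ _ [X Y Z f g h d].
  have d' := LocImage shiftV (tf_dist F d).
  apply: (iso_closure_heq d') => //.
  exact: loc_hom_comp.
Defined.

End LocTriFunctor.

Lemma cone_in_trifunctor (S T : tricat) (N : S -> Prop) (N' : T -> Prop)
    (F : trifunctor S T) : (forall X, N X -> N' (F X)) ->
  forall (X Y : S) (f : mor X Y), cone_in N f -> cone_in N' (fmap F f).
Proof.
move=> NN' X Y f [Z [g [h [d NZ]]]].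
exists (F Z), (fmap F g), (tf_shift F X \oc fmap F h).
by split; [exact: tf_dist | exact: NN'].
Qed.

(** * Modules and complexes *)

Section ModHoms.
Variables (K : fieldType) (C : kcat K).
Implicit Types F G H : kmodule C.

(** Leibniz equality of pointwise equal maps lets an [afunctor], whose action on maps carries no
    congruence axiom, be applied to equations between module maps. *)
Lemma modhomP F G (s t : modhom F G) : (forall x v, s x v = t x v) -> s = t.
Proof.
case: s t => [s s1 s2] [t t1 t2] /= e.
have {}e : s = t by apply: functional_extensionality_dep => x; apply: funext => v.
by subst t; congr ModHom; apply: Prop_irrelevance.
Qed.

Lemma mhD F G (s : modhom F G) x u v : s x (u + v) = s x u + s x v.
Proof. exact: linearD. Qed.

Lemma mhN F G (s : modhom F G) x u : s x (- u) = - s x u.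
Proof. exact: linearN. Qed.

Lemma mh0 F G (s : modhom F G) x : s x 0 = 0.
Proof. exact: linear0. Qed.

Definition modhom_zero F G : modhom F G.
Proof.
refine (@ModHom K C F G (fun x v => 0) _ _).
- by move=> x a u v; rewrite scaler0 addr0.
- by move=> x y f v; rewrite linear0.
Defined.

Definition modin1 F G : modhom F (modsum F G).
Proof.
refine (@ModHom K C F (modsum F G) (fun x v => (v, 0)) _ _).
- by move=> x a u v; congr (_, _); rewrite /= scaler0 addr0.
- by move=> x y f v; rewrite /= linear0.
Defined.

Definition modin2 F G : modhom G (modsum F G).
Proof.
refine (@ModHom K C G (modsum F G) (fun x v => (0, v)) _ _).
- by move=> x a u v; congr (_, _); rewrite /= scaler0 addr0.
- by move=> x y f v; rewrite /= linear0.
Defined.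

Definition modpr1 F G : modhom (modsum F G) F :=
  @ModHom K C (modsum F G) F (fun x p => p.1) (fun _ _ _ _ => erefl) (fun _ _ _ _ => erefl).

Definition modpr2 F G : modhom (modsum F G) G :=
  @ModHom K C (modsum F G) G (fun x p => p.2) (fun _ _ _ _ => erefl) (fun _ _ _ _ => erefl).

Definition modpair F G H (f : modhom H F) (g : modhom H G) : modhom H (modsum F G).
Proof.
refine (@ModHom K C H (modsum F G) (fun x v => (f x v, g x v)) _ _).
- by move=> x a u v; rewrite !linearP.
- by move=> x y k v; rewrite /= !mh_nat.
Defined.

Lemma mod_epi_surj F G (g : modhom F G) :
  (forall x w, exists v, g x v = w) -> @epi (Mod C) F G g.
Proof. by move=> gs Z u v e x w; have [z <-] := gs x w; exact: e. Qed.

(** Quotients are taken object by object; the action descends because the images of [g] are stable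
    under it. *)
Lemma coker_exists F G (g : modhom F G) :
  exists (Z : kmodule C) (q : modhom G Z),
    (forall x z, exists w, q x w = z) /\
    forall x w, q x w = 0 <-> exists v, g x v = w.
Proof.
have sub x : subspace (fun w : G x => exists v, g x v = w).
  split=> [|a _ _ [u <-] [v <-]]; first by exists 0; rewrite linear0.
  by exists (a *: u + v); rewrite linearP.
pose Q x := sval (cid (quotient_space (sub x))).
pose hq x := cid (svalP (cid (quotient_space (sub x)))).
pose q x : G x -> Q x := sval (hq x).
have ql x : linear (q x) by have [] := svalP (hq x).
have qs x z : exists w, q x w = z by have [_ h _] := svalP (hq x); exact: h.
have qk x w : q x w = 0 <-> exists v, g x v = w by have [_ _ h] := svalP (hq x); exact: h.
have ex x y (f : khom C x y) : exists qf : Q x -> Q y,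
    forall v, qf (q x v) = q y (mact G f v).
  have [s hs] := choice (qs x).
  exists (fun z => q y (mact G f (s z))) => v.
  apply/subr0_eq; rewrite -scaleN1r addrC -(ql y) -linearP; apply/qk.
  have /qk[u hu] : q x (-1 *: v + s (q x v)) = 0.
    by rewrite ql hs scaleN1r addNr.
  by exists (mact F f u); rewrite mh_nat hu.
pose qf x y f := sval (cid (ex x y f)).
have qfE x y f v : qf x y f (q x v) = q y (mact G f v) by exact: (svalP (cid (ex x y f))).
have p1 x y (f : khom C x y) : linear (qf x y f).
  move=> a u v; have [u' <-] := qs x u; have [v' <-] := qs x v.
  by rewrite -ql !qfE linearP ql.
have p2 x y (v : Q x) : linear (fun f : khom C x y => qf x y f v).
  move=> a f f'; have [v' <-] := qs x v.
  by rewrite !qfE -ql mact_hom_lin.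
have p3 x v : qf x x (kid x) v = v.
  by have [v' <-] := qs x v; rewrite qfE mact_id.
have p4 x y z (k : khom C y z) (f : khom C x y) v :
    qf x z (kcomp k f) v = qf y z k (qf x y f v).
  by have [v' <-] := qs x v; rewrite !qfE mact_comp.
pose Z := @KModule K C Q qf p1 p2 p3 p4.
by exists Z, (@ModHom K C G Z q ql (fun x y f v => esym (qfE x y f v))).
Qed.

(** The cokernel projection and the zero map agree after composition with [g]. If [g] is epi they
    are equal, so every element dies in the cokernel and lies in the image. *)
Lemma epi_mod_surj F G (g : modhom F G) :
  @epi (Mod C) F G g -> forall x w, exists v, g x v = w.
Proof.
have [Z [q [_ qk]]] := coker_exists g.
move=> /(_ Z q (modhom_zero G Z)) h x w; apply/qk; apply: h => {w}x v /=.
by apply/qk; exists v.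
Qed.

Lemma factor_surj F G H (q : modhom F G) (h : modhom F H) :
  (forall x w, exists v, q x v = w) -> (forall x v, q x v = 0 -> h x v = 0) ->
  exists k : modhom G H, forall x v, k x (q x v) = h x v.
Proof.
move=> qs hq; pose s x w := sval (cid (qs x w)).
have hs x w : q x (s x w) = w by exact: svalP (cid (qs x w)).
have hE x u v : q x u = q x v -> h x u = h x v.
  move=> e; apply/subr0_eq; rewrite -linearB; apply: hq.
  by rewrite linearB /= e subrr.
have k1 x : linear (fun w => h x (s x w)).
  by move=> a u v; rewrite -linearP; apply: hE; rewrite linearP /= !hs.
have k2 x y (f : khom C x y) v : h y (s y (mact G f v)) = mact H f (h x (s x v)).
  by rewrite -mh_nat; apply: hE; rewrite mh_nat !hs.
by exists (@ModHom K C G H _ k1 k2) => x v; apply: hE; rewrite hs.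
Qed.

Lemma proj_lift (P F G : kmodule C) (g : modhom F G) (f : modhom P G) :
  @projective (Mod C) P -> (forall x w, exists v, g x v = w) ->
  exists h : modhom P F, forall x v, g x (h x v) = f x v.
Proof. by move=> hP /mod_epi_surj /hP /(_ f). Qed.

End ModHoms.

(** * Acyclic complexes, quasi-isomorphisms and cones *)

Section Complexes.
Variables (K : fieldType) (C : kcat K).
Implicit Types X Y Z : bcomplex C.

(** Termwise inverses of a chain map commute with the differentials automatically. *)
Lemma chmap_inverse_iso X Y (f : chmap X Y) (g : forall n, modhom (Y n) (X n)) :
  (forall n x v, g n x (f n x v) = v) -> (forall n x v, f n x (g n x v) = v) ->
  exists g' : chmap Y X, (forall n, g' n = g n) /\ @is_iso (Kb C) X Y f.
Proof.
move=> fK gK; have gd n x v : g (n + 1) x (cdiff Y n x v) = cdiff X n x (g n x v).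
  by rewrite -{1}[v]gK -cm_comm fK.
pose g' := @ChMap K C Y X g gd; exists g'; split=> //; exists g'.
by split; apply: homotopic_eq => n x v; rewrite /= ?fK ?gK.
Qed.

Definition acyclic X : Prop :=
  forall n x (z : X (n + 1) x), cdiff X (n + 1) x z = 0 -> exists w, z = cdiff X n x w.

Lemma acyclic_retract X Y (f : chmap X Y) (g : chmap Y X) :
  (forall n x v, g n x (f n x v) = v) -> acyclic Y -> acyclic X.
Proof.
move=> fK aY n x z dz.
have [|w e] := aY n x (f (n + 1) x z); first by rewrite -cm_comm dz linear0.
by exists (g n x w); rewrite -cm_comm -e fK.
Qed.

(** The long exact cohomology sequence of the cone, carried out on elements. *)
Lemma quasi_iso_cone X Y (f : chmap X Y) : @quasi_iso K C X Y f <-> acyclic (cone f).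
Proof.
split=> [qf n x [u v] [] /eqP|ac n x].
  rewrite oppr_eq0 => /eqP /= du fu.
  have [inj _] := qf (n + 1) x; have [_ surj] := qf n x.
  have [|u' eu] := inj u du; first by exists (- v); rewrite linearN; apply/eqP; rewrite -addr_eq0; apply/eqP.
  have [|u1 [v1 [du1 e1]]] := surj (f (n + 1) x u' + v).
    by rewrite linearD /= -cm_comm -eu fu.
  exists (u1 - u', v1); congr (_, _); first by rewrite /= linearB /= du1 sub0r opprK.
  by rewrite /= linearB /= addrAC -e1 addrAC subrr add0r.
split=> [z dz [w fz]|w dw].
  (* The cocycle [(z, - w)] sits in degree [n] of the cone, while acyclicity speaks about degrees of
     the form [m + 1]. *)
  have [m em] : exists m, n = m + 1 by exists (n - 1); rewrite subrK.
  subst n; have [|[z' w'] [e1 _]] := ac m x (z, - w).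
    by congr (_, _) => /=; rewrite ?dz ?oppr0 // linearN fz subrr.
  by exists (- z'); rewrite linearN.
have [|[z v] [e1 e2]] := ac n x (0, w).
  by congr (_, _) => /=; rewrite ?linear0 ?oppr0 // add0r.
exists z, v; split=> //; apply/eqP; rewrite -oppr_eq0; exact/eqP/esym.
Qed.

Lemma quasi_iso_Db X Y (f : chmap X Y) : @quasi_iso K C X Y f -> @isomorphic (Db C) X Y.
Proof. by move=> qf; exists (loc_hom _ (f : @mor (Kb C) X Y)); apply: loc_hom_iso. Qed.

Lemma proj_Perf X : (forall n, @projective (Mod C) (X n)) -> @Perf K C X.
Proof. by move=> hX; exists X; split=> //; exists (idc _); apply: iso_id. Qed.

Lemma Perf_iso X Y : @isomorphic (Db C) X Y -> @Perf K C Y -> @Perf K C X.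
Proof. by move=> i [P [hP j]]; exists P; split=> //; apply: isomorphic_trans i j. Qed.

Section ConeIn.
Variables (P X : bcomplex C) (f : chmap P X).

(** Rotation of the cone triangle: the cone of X -> Cone(f) is P[1] up to quasi-isomorphism. *)
Definition cone_in_out : chmap (cone (cone_in_map f)) (cshift P).
Proof.
exact: (@ChMap K C (cone (cone_in_map f)) (cshift P)
  (fun n => modhom_comp (modpr1 _ _) (modpr2 _ _)) (fun n x v => add0r _)).
Defined.

Lemma cone_in_out_quasi_iso : @quasi_iso K C _ _ cone_in_out.
Proof.
move=> n x; split=> [[u [p v]] [/eqP]|p dp].
  rewrite oppr_eq0 /= add0r => /eqP du /eqP; rewrite oppr_eq0 => /eqP dp.
  move=> e [w ew]; exists (v - f _ x w, (w, 0)).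
  congr (_, (_, _)); rewrite /= ?linear0 ?add0r ?addr0 ?subrK // linearB /= -cm_comm.
  have -> : cdiff P (n + 1) x w = - p by rewrite ew opprK.
  by rewrite linearN opprK; apply/eqP; rewrite -addr_eq0 [X in _ + X == _]addrC; apply/eqP.
exists (- f _ x p, (p, 0)), 0; rewrite /= in dp.
have {}dp : cdiff P (n + 1 + 1) x p = 0 by apply/eqP; rewrite -oppr_eq0; exact/eqP.
split; last by rewrite linear0 addr0.
congr (_, (_, _)) => /=; rewrite ?linearN /= -?cm_comm ?dp ?linear0 ?oppr0 ?addr0 ?addNr //.
Qed.

(** The third vertex of the triangle on X -> Cone(f) is P[1] up to quasi-isomorphism, hence perfect.
    The isomorphism [e] allows for a source that is [X] only up to isomorphism. *)
Lemma cone_in_Perf (Y : Kb C) (e : @mor (Kb C) Y X) :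
  is_iso e -> (forall n, @projective (Mod C) (P n)) ->
  @cone_in (Db C) (@Perf K C) Y (cone f)
    (loc_hom _ ((cone_in_map f : @mor (Kb C) _ _) \oc e)).
Proof.
move=> [e' [e1 e2]] hP.
have d := @iso_closure_precomp (Kb C) (Kb_shift C) (@cone_triangle K C) _ _ _ _ _ _ _ _ _
  (ConeTriangle (cone_in_map f)) e2 e1.
exists (cone (cone_in_map f)), (loc_hom _ (cone_in_map (cone_in_map f) : @mor (Kb C) _ _)).
exists (loc_hom _ (fmap (Kb_shift C) e' \oc (cone_out_map (cone_in_map f) : @mor (Kb C) _ _))).
split; first exact: iso_closure_incl (LocImage (@quasi_iso_shift K C) d).
apply: Perf_iso (quasi_iso_Db cone_in_out_quasi_iso) _.
by apply: proj_Perf => n; apply: hP.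
Qed.

End ConeIn.

End Complexes.

(** * Cones of natural transformations *)

(* Additive functors Mod(C) -> Mod(D).                                          *)
Record afunctor (K : fieldType) (C D : kcat K) := AFunctor {
  afob :> kmodule C -> kmodule D;
  afmap : forall F G, modhom F G -> modhom (afob F) (afob G);
  afmap_id : forall F x v, afmap (modhom_id F) x v = v;
  afmap_comp : forall F G H (g : modhom G H) (f : modhom F G) x v,
    afmap (modhom_comp g f) x v = afmap g x (afmap f x v);
  afmap_add : forall F G (f g : modhom F G) x v,
    afmap (modhom_add f g) x v = afmap f x v + afmap g x v
}.
Arguments afmap {K C D} _ {F G} _.
Arguments afmap_id {K C D} _ {F} x v.
Arguments afmap_comp {K C D} _ {F G H} g f x v.
Arguments afmap_add {K C D} _ {F G} f g x v.

Record afnat (K : fieldType) (C D : kcat K) (S T : afunctor C D) := AFNat {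
  an :> forall F, modhom (S F) (T F);
  an_nat : forall F G (f : modhom F G) x v,
    an G x (afmap S f x v) = afmap T f x (an F x v)
}.
Arguments an {K C D S T} _ _.

(** * Additive functors applied termwise to complexes *)

Section AFunctor.
Variables (K : fieldType) (C D : kcat K).
Implicit Types F G H : kmodule C.

Section Termwise.
Variable T : afunctor C D.

Lemma afmap0 F G (f : modhom F G) : (forall x v, f x v = 0) ->
  forall x v, afmap T f x v = 0.
Proof.
move=> f0 x v; have e : f = modhom_add f f.
  by apply: modhomP => y w; rewrite /= f0 addr0.
have := afmap_add T f f x v; rewrite -e => /eqP.
by rewrite -subr_eq0 opprD addrA subrr sub0r oppr_eq0 => /eqP.
Qed.

Lemma afmap_opp F G (f : modhom F G) x v :
  afmap T (modhom_opp f) x v = - afmap T f x v.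
Proof.
apply/eqP; rewrite -addr_eq0 -afmap_add; apply/eqP.
by apply: afmap0 => y w; rewrite /= addNr.
Qed.

Lemma afmap_compl F G H (g : modhom G H) (f : modhom F G) (h : modhom F H) :
  (forall x v, g x (f x v) = h x v) ->
  forall x v, afmap T g x (afmap T f x v) = afmap T h x v.
Proof.
by move=> e x v; rewrite -afmap_comp; congr (afmap T _ x v); apply: modhomP.
Qed.

Lemma afmap_cancel F G (f : modhom F G) (g : modhom G F) :
  (forall x v, g x (f x v) = v) -> forall x v, afmap T g x (afmap T f x v) = v.
Proof.
by move=> e x v; rewrite (afmap_compl (h := modhom_id F)) // afmap_id.
Qed.

Lemma afmap_sq F G G' H (g : modhom G H) (f : modhom F G) (g' : modhom G' H)
    (f' : modhom F G') : (forall x v, g x (f x v) = g' x (f' x v)) ->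
  forall x v, afmap T g x (afmap T f x v) = afmap T g' x (afmap T f' x v).
Proof.
move=> e x v; rewrite (afmap_compl (h := modhom_comp g' f')) ?afmap_comp //.
Qed.

Definition af_complex (X : bcomplex C) : bcomplex D.
Proof.
refine (@BComplex K D (fun n => T (X n)) (fun n => afmap T (cdiff X n)) _ _).
- move=> n x v; rewrite -afmap_comp; apply: afmap0 => y w; exact: cdiffK.
- case: (cbounded X) => N h; exists N => n hn x v.
  by rewrite -[v](afmap_id T) afmap0 // => y w; apply: h.
Defined.

Definition af_chmap (X Y : bcomplex C) (f : chmap X Y) :
  chmap (af_complex X) (af_complex Y).
Proof.
refine (@ChMap K D (af_complex X) (af_complex Y) (fun n => afmap T (f n)) _).
move=> n x v; apply: afmap_sq => {x v} x v; exact: cm_comm.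
Defined.

Lemma afmap_homotopy (X Y : bcomplex C) (f g : chmap X Y)
    (s : forall n, modhom (X (n + 1)) (Y n)) :
  (forall n x (v : X (n + 1) x), f (n + 1) x v - g (n + 1) x v
    = cdiff Y n x (s n x v) + s (n + 1) x (cdiff X (n + 1) x v)) ->
  forall n x v, afmap T (f (n + 1)) x v - afmap T (g (n + 1)) x v
    = afmap T (cdiff Y n) x (afmap T (s n) x v)
      + afmap T (s (n + 1)) x (afmap T (cdiff X (n + 1)) x v).
Proof.
move=> h n x v; rewrite -afmap_opp -afmap_add -!afmap_comp -afmap_add.
by congr (afmap T _ x v); apply: modhomP => y w; exact: h.
Qed.

Definition Kb_af : functor (Kb C) (Kb D).
Proof.
refine (@Functor (Kb_cat C) (Kb_cat D) af_complex af_chmap _ _ _).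
- move=> X Y f g [s h]; exists (fun n => afmap T (s n)).
  exact: afmap_homotopy.
- by move=> X; apply: homotopic_eq => n x v; exact: afmap_id.
- by move=> X Y Z g f; apply: homotopic_eq => n x v; exact: afmap_comp.
Defined.

Definition af_shift_map X : chmap (af_complex (cshift X)) (cshift (af_complex X)).
Proof.
refine (@ChMap K D (af_complex (cshift X)) (cshift (af_complex X))
  (fun n => modhom_id _) _).
by move=> n x v; rewrite /= afmap_opp.
Defined.

Definition Kb_af_shift :
  natiso (fcomp Kb_af (tshift (Kb C))) (fcomp (tshift (Kb D)) Kb_af).
Proof.
refine (@NatIso _ _ (fcomp Kb_af (Kb_shift C)) (fcomp (Kb_shift D) Kb_af)
  af_shift_map _ _).
- by move=> X Y f; apply: homotopic_eq.
- move=> X; have [//|//|g' [_ i]] := @chmap_inverse_iso _ _ _ _ (af_shift_map X)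
    (fun n => modhom_id _).
  exact: i.
Defined.

Section ConeCompare.
Variables (X Y : bcomplex C) (f : chmap X Y).

(** The canonical isomorphism by which an additive functor preserves biproducts; it identifies the
    cone of [T f] with [T] of the cone of [f]. *)
Definition af_cone_hom n : modhom (modsum (T (X (n + 1))) (T (Y n)))
    (T (modsum (X (n + 1)) (Y n))) :=
  modhom_add (modhom_comp (afmap T (modin1 _ _)) (modpr1 _ _))
             (modhom_comp (afmap T (modin2 _ _)) (modpr2 _ _)).

Definition af_cone_inv n : modhom (T (modsum (X (n + 1)) (Y n)))
    (modsum (T (X (n + 1))) (T (Y n))) :=
  modpair (afmap T (modpr1 _ _)) (afmap T (modpr2 _ _)).

Lemma afmap_in_pr F G x v :
  afmap T (modin1 F G) x (afmap T (modpr1 F G) x v)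
  + afmap T (modin2 F G) x (afmap T (modpr2 F G) x v) = v.
Proof.
rewrite -!afmap_comp -afmap_add -[RHS](afmap_id T).
congr (afmap T _ x v); apply: modhomP => y [u w].
by rewrite /=; congr (_, _); rewrite /= ?addr0 ?add0r.
Qed.

Lemma afmap_pr1_in F G x u v :
  afmap T (modpr1 F G) x (afmap T (modin1 F G) x u + afmap T (modin2 F G) x v) = u.
Proof.
rewrite linearD /= afmap_cancel // -[X in _ + X]afmap_comp afmap0 ?addr0 //.
Qed.

Lemma afmap_pr2_in F G x u v :
  afmap T (modpr2 F G) x (afmap T (modin1 F G) x u + afmap T (modin2 F G) x v) = v.
Proof.
rewrite linearD /= [X in _ + X]afmap_cancel // -afmap_comp afmap0 ?add0r //.
Qed.

Lemma af_cone_homK n x v : af_cone_inv n x (af_cone_hom n x v) = v.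
Proof. by case: v => u v; rewrite /= afmap_pr1_in afmap_pr2_in. Qed.

Lemma af_cone_invK n x v : af_cone_hom n x (af_cone_inv n x v) = v.
Proof. exact: afmap_in_pr. Qed.

Lemma afmap_cone_in1 n x v :
  afmap T (cone_diff f n) x (afmap T (modin1 _ _) x v) =
  - afmap T (modin1 _ _) x (afmap T (cdiff X (n + 1)) x v)
  + afmap T (modin2 _ _) x (afmap T (f (n + 1)) x v).
Proof.
rewrite -!afmap_comp -afmap_opp -afmap_add; congr (afmap T _ x v).
apply: modhomP => y w /=.
by congr (_, _); rewrite /= ?linear0 ?oppr0 ?addr0 ?add0r.
Qed.

Lemma afmap_cone_in2 n x v :
  afmap T (cone_diff f n) x (afmap T (modin2 _ _) x v) =
  afmap T (modin2 _ _) x (afmap T (cdiff Y n) x v).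
Proof.
apply: afmap_sq => y w /=.
by congr (_, _); rewrite /= ?linear0 ?oppr0 ?addr0 ?add0r.
Qed.

Definition af_cone_map : chmap (cone (af_chmap f)) (af_complex (cone f)).
Proof.
refine (@ChMap K D (cone (af_chmap f)) (af_complex (cone f)) af_cone_hom _).
move=> n x [u v] /=; rewrite [RHS]linearD /= afmap_cone_in1 afmap_cone_in2.
by rewrite linearN linearD /= addrA.
Defined.

End ConeCompare.

Lemma iso_closure_cone_triangle (X Y : bcomplex D) (Z : bcomplex D) (f : chmap X Y)
    (c : @mor (Kb D) (cone f) Z) (g : @mor (Kb D) Y Z) (h : @mor (Kb D) Z (cshift X)) :
  is_iso c -> c \oc (cone_in_map f : @mor (Kb D) _ _) =h g ->
  h \oc c =h (cone_out_map f : @mor (Kb D) _ _) ->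
  iso_closure (@cone_triangle K D) (f : @mor (Kb D) _ _) g h.
Proof.
move=> ic e1 e2.
exists X, Y, (cone f), (f : @mor (Kb D) _ _), (cone_in_map f : @mor (Kb D) _ _).
exists (cone_out_map f : @mor (Kb D) _ _), (idc _), (idc _), c.
split; first by split; [exact: ConeTriangle | exact: iso_id.. | exact: ic].
split; first by rewrite mcomp1l mcomp1r.
  by rewrite mcomp1r e1.
by rewrite e2 fmap_id mcomp1l.
Qed.

Definition Kb_af_tri : trifunctor (Kb C) (Kb D).
Proof.
refine (@TriFunctor (Kb C) (Kb D) Kb_af Kb_af_shift _ _).
- move=> X Y f g h [s e]; apply: (@homotopic_trans _ _ _ _ _
    (af_chmap (chmap_add f g))).
    by apply: homotopic_eq => n x v; rewrite /= afmap_add.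
  by apply: (fmap_heq Kb_af); exists s.
- apply: iso_closure_functor => _ _ _ _ _ _ [X Y f].
  apply: (@iso_closure_cone_triangle _ _ _ _ (af_cone_map f)).
  + have [g' [_ i]] := chmap_inverse_iso (f := af_cone_map f) (@af_cone_homK X Y)
      (@af_cone_invK X Y).
    exact: i.
  + by apply: homotopic_eq => n x v; rewrite /= linear0 add0r.
  + by apply: homotopic_eq => n x [u v]; exact: afmap_pr1_in.
Defined.

End Termwise.

(** Exactness in the middle is phrased as an inclusion of the kernel in the image, the form in which
    [acyclic] is phrased. *)
Definition af_exact (T : afunctor C D) : Prop :=
  forall F G H (f : modhom F G) (g : modhom G H),
    (forall x v, g x v = 0 -> exists u, v = f x u) ->
    forall x v, afmap T g x v = 0 -> exists u, v = afmap T f x u.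

Lemma af_exact_acyclic (T : afunctor C D) X : af_exact T -> acyclic X ->
  acyclic (af_complex T X).
Proof. by move=> eT aX n; apply: eT => x v; exact: aX. Qed.

(** Quasi-isomorphisms are the maps with acyclic cone, and [T] preserves both cones (up to
    isomorphism) and acyclicity. *)
Lemma Kb_af_quasi_iso (T : afunctor C D) : af_exact T ->
  forall (X Y : Kb C) (f : mor X Y), quasi_iso f -> quasi_iso (fmap (Kb_af_tri T) f).
Proof.
move=> eT X Y f /quasi_iso_cone /(af_exact_acyclic eT) ac.
have [g [eg _]] := chmap_inverse_iso (f := af_cone_map T f) (@af_cone_homK T X Y)
  (@af_cone_invK T X Y).
apply/quasi_iso_cone; apply: (acyclic_retract (f := af_cone_map T f) (g := g)) ac.
by move=> n x v; rewrite eg; exact: af_cone_homK.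
Qed.

End AFunctor.

(** * The cone of a natural transformation as a triangle functor, and its comparison with the
    cokernel *)

Section ConeFunctor.
Variables (K : fieldType) (C D : kcat K) (S T : afunctor C D) (phi : afnat S T).
Implicit Types F G H : kmodule C.
Implicit Types X Y Z : bcomplex C.

Definition an_chmap X : chmap (af_complex S X) (af_complex T X) :=
  @ChMap K D (af_complex S X) (af_complex T X) (fun n => phi (X n))
    (fun n x v => an_nat phi (cdiff X n) v).

Definition ancone X : bcomplex D := cone (an_chmap X).

Definition modsum_map (E : kcat K) (F F' G G' : kmodule E) (f : modhom F F')
    (g : modhom G G') : modhom (modsum F G) (modsum F' G') :=
  modpair (modhom_comp f (modpr1 _ _)) (modhom_comp g (modpr2 _ _)).

Definition ancone_map X Y (f : chmap X Y) : chmap (ancone X) (ancone Y).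
Proof.
refine (@ChMap K D (ancone X) (ancone Y)
  (fun n => modsum_map (afmap S (f (n + 1))) (afmap T (f n))) _).
move=> n x [u v]; congr (_, _).
  rewrite /= linearN; congr (- _).
  by apply: afmap_sq => y w; exact: cm_comm.
rewrite /= linearD /= -an_nat; congr (_ + _).
by apply: afmap_sq => y w; exact: cm_comm.
Defined.

Definition Kb_ancone : functor (Kb C) (Kb D).
Proof.
refine (@Functor (Kb_cat C) (Kb_cat D) ancone ancone_map _ _ _).
- move=> X Y f g [s h].
  (* The [S]-summand of the cone is shifted and has differential [- d], so its homotopy changes sign
     too. *)
  exists (fun n => modsum_map (modhom_opp (afmap S (s (n + 1)))) (afmap T (s n))).
  move=> n x [u v]; congr (_, _).
    by rewrite /= !linearN !opprK; exact: (@afmap_homotopy _ _ _ S _ _ _ _ s h (n + 1) x u).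
  rewrite /= [X in _ = _ + X]linearD /= -an_nat linearN /=.
  rewrite [RHS]addrACA addNr add0r.
  exact: (@afmap_homotopy _ _ _ T _ _ _ _ s h n x v).
- move=> X; apply: homotopic_eq => n x [u v].
  by congr (_, _); exact: afmap_id.
- move=> X Y Z g f; apply: homotopic_eq => n x [u v].
  by congr (_, _); exact: afmap_comp.
Defined.

Definition ancone_shift_map X : chmap (ancone (cshift X)) (cshift (ancone X)).
Proof.
refine (@ChMap K D (ancone (cshift X)) (cshift (ancone X))
  (fun n => sign_hom (S (X (n + 1 + 1))) (T (X (n + 1)))) _).
move=> n x [u v]; congr (_, _); rewrite /= !afmap_opp.
  by rewrite !opprK linearN.
by rewrite opprD linearN opprK.
Defined.

Definition Kb_ancone_shift :
  natiso (fcomp Kb_ancone (tshift (Kb C))) (fcomp (tshift (Kb D)) Kb_ancone).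
Proof.
refine (@NatIso _ _ (fcomp Kb_ancone (Kb_shift C)) (fcomp (Kb_shift D) Kb_ancone)
  ancone_shift_map _ _).
- move=> X Y f; apply: homotopic_eq => n x [u v].
  by congr (_, _); rewrite /= ?linearN.
- move=> X; have [||g' [_ i]] := @chmap_inverse_iso _ _ _ _ (ancone_shift_map X)
    (fun n => sign_hom _ _).
  + by move=> n x [u v]; rewrite /= opprK.
  + by move=> n x [u v]; rewrite /= opprK.
  exact: i.
Defined.

Section ConeCompare.
Variables (X Y : bcomplex C) (f : chmap X Y).

(* The sign compensates the one in the comparison ancone_shift_map.             *)
Definition ancone_cone_hom n : modhom (cone (ancone_map f) n) (ancone (cone f) n) :=
  modpair
    (modhom_add
      (modhom_opp (modhom_comp (afmap S (modin1 _ _)) (modhom_comp (modpr1 _ _) (modpr1 _ _))))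
      (modhom_comp (afmap S (modin2 _ _)) (modhom_comp (modpr1 _ _) (modpr2 _ _))))
    (modhom_add
      (modhom_comp (afmap T (modin1 _ _)) (modhom_comp (modpr2 _ _) (modpr1 _ _)))
      (modhom_comp (afmap T (modin2 _ _)) (modhom_comp (modpr2 _ _) (modpr2 _ _)))).

Definition ancone_cone_inv n : modhom (ancone (cone f) n) (cone (ancone_map f) n) :=
  modpair
    (modpair (modhom_opp (modhom_comp (afmap S (modpr1 _ _)) (modpr1 _ _)))
             (modhom_comp (afmap T (modpr1 _ _)) (modpr2 _ _)))
    (modpair (modhom_comp (afmap S (modpr2 _ _)) (modpr1 _ _))
             (modhom_comp (afmap T (modpr2 _ _)) (modpr2 _ _))).

Lemma ancone_cone_homK n x v : ancone_cone_inv n x (ancone_cone_hom n x v) = v.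
Proof.
case: v => [[a b] [a' b']]; congr ((_, _), (_, _)) => /=.
- by rewrite -[- afmap S (modin1 _ _) x a]linearN afmap_pr1_in opprK.
- exact: afmap_pr1_in.
- by rewrite -[- afmap S (modin1 _ _) x a]linearN afmap_pr2_in.
- exact: afmap_pr2_in.
Qed.

Lemma ancone_cone_invK n x v : ancone_cone_hom n x (ancone_cone_inv n x v) = v.
Proof.
case: v => [a b]; congr (_, _) => /=; last exact: afmap_in_pr.
by rewrite linearN opprK; exact: afmap_in_pr.
Qed.

Let ACsum (V : zmodType) (p q r s t : V) :
  p + q + (r + (s + t)) = p + s + (q + r + t).
Proof. by rewrite !addrA; congr (_ + _); rewrite -!addrA; congr (_ + _); rewrite addrA addrC. Qed.

Definition ancone_cone_map : chmap (cone (ancone_map f)) (ancone (cone f)).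
Proof.
refine (@ChMap K D (cone (ancone_map f)) (ancone (cone f)) ancone_cone_hom _).
move=> n x [[a b] [a' b']]; congr (_, _) => /=.
  rewrite !(mhD, mhN, opprK) afmap_cone_in1 afmap_cone_in2.
  by rewrite !(opprD, opprK) !addrA.
rewrite !(mhD, mhN) !an_nat afmap_cone_in1 afmap_cone_in2.
rewrite opprD; apply: ACsum.
Defined.

End ConeCompare.

Definition Kb_ancone_tri : trifunctor (Kb C) (Kb D).
Proof.
refine (@TriFunctor (Kb C) (Kb D) Kb_ancone Kb_ancone_shift _ _).
- move=> X Y f g h [s e]; apply: (@homotopic_trans _ _ _ _ _
    (ancone_map (chmap_add f g))).
    by apply: homotopic_eq => n x v; congr (_, _); rewrite /= afmap_add.
  by apply: (fmap_heq Kb_ancone); exists s.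
- apply: iso_closure_functor => _ _ _ _ _ _ [X Y f].
  apply: (@iso_closure_cone_triangle _ _ _ _ _ _ (ancone_cone_map f)).
  + have [g' [_ i]] := chmap_inverse_iso (f := ancone_cone_map f) (@ancone_cone_homK X Y f)
      (@ancone_cone_invK X Y f).
    exact: i.
  + apply: homotopic_eq => n x [u v].
    by congr (_, _); rewrite /= linear0 ?oppr0 add0r.
  + apply: homotopic_eq => n x [[a b] [a' b']].
    congr (_, _); rewrite /=; last exact: afmap_pr1_in.
    by rewrite -[- afmap S (modin1 _ _) x a]linearN afmap_pr1_in opprK.
Defined.

Lemma ancone_acyclic X : acyclic (af_complex S X) -> acyclic (af_complex T X) ->
  acyclic (ancone X).
Proof.
move=> aS aT n x [a b] [] /= /eqP; rewrite oppr_eq0 => /eqP da e.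
have [a' ea] := aS _ _ a da; subst a.
have [|b' eb] := aT _ _ (an phi (X (n + 1)) x a' + b).
  by rewrite linearD /= -an_nat.
exists (- a', b'); congr (_, _); first by rewrite /= linearN opprK.
rewrite /= in eb; rewrite /= -eb linearN addrA addNr add0r //.
Qed.

(** Up to exchanging summands, the cone of [ancone_map f] is [ancone] of the cone of [f]. The latter
    is a cone between two complexes that are acyclic by exactness of [S] and [T]. *)
Lemma Kb_ancone_quasi_iso : af_exact S -> af_exact T ->
  forall (X Y : Kb C) (f : mor X Y), quasi_iso f -> quasi_iso (fmap Kb_ancone_tri f).
Proof.
move=> eS eT X Y f /quasi_iso_cone ac.
have [g [eg _]] := chmap_inverse_iso (f := ancone_cone_map f) (@ancone_cone_homK X Y f)
  (@ancone_cone_invK X Y f).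
apply/quasi_iso_cone; apply: (acyclic_retract (f := ancone_cone_map f) (g := g)).
  by move=> n x v; rewrite eg; exact: ancone_cone_homK.
by apply: ancone_acyclic; apply: af_exact_acyclic.
Qed.

Definition af_coker_at F := cid (coker_exists (phi F)).
Definition af_coker_ob F : kmodule D := sval (af_coker_at F).
Definition af_coker_proj F : modhom (T F) (af_coker_ob F) :=
  sval (cid (svalP (af_coker_at F))).

Lemma af_coker_surj F x z : exists w, af_coker_proj F x w = z.
Proof. by have [h _] := svalP (cid (svalP (af_coker_at F))); exact: h. Qed.

Lemma af_coker_ker F x w : af_coker_proj F x w = 0 <-> exists v, phi F x v = w.
Proof. by have [_ h] := svalP (cid (svalP (af_coker_at F))); exact: h. Qed.

Lemma af_coker_map_exists F G (f : modhom F G) :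
  exists k : modhom (af_coker_ob F) (af_coker_ob G),
    forall x v, k x (af_coker_proj F x v) = af_coker_proj G x (afmap T f x v).
Proof.
apply: (@factor_surj _ _ _ _ _ (af_coker_proj F)
  (modhom_comp (af_coker_proj G) (afmap T f))); first exact: af_coker_surj.
move=> x _ /af_coker_ker[v <-] /=; apply/af_coker_ker.
by exists (afmap S f x v); rewrite an_nat.
Qed.

Definition af_coker_map F G (f : modhom F G) := sval (cid (af_coker_map_exists f)).

Lemma af_coker_mapE F G (f : modhom F G) x v :
  af_coker_map f x (af_coker_proj F x v) = af_coker_proj G x (afmap T f x v).
Proof. exact: svalP (cid (af_coker_map_exists f)) x v. Qed.

Definition af_coker : afunctor C D.
Proof.
refine (@AFunctor K C D af_coker_ob af_coker_map _ _ _).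
- move=> F x v; have [w <-] := af_coker_surj v.
  by rewrite af_coker_mapE afmap_id.
- move=> F G H g f x v; have [w <-] := af_coker_surj v.
  by rewrite !af_coker_mapE afmap_comp.
- move=> F G f g x v; have [w <-] := af_coker_surj v.
  by rewrite !af_coker_mapE afmap_add linearD.
Defined.

Definition ancone_coker X : chmap (ancone X) (af_complex af_coker X).
Proof.
refine (@ChMap K D (ancone X) (af_complex af_coker X)
  (fun n => modhom_comp (af_coker_proj (X n)) (modpr2 _ _)) _).
move=> n x [u v] /=; rewrite af_coker_mapE linearD /=.
by rewrite (_ : af_coker_proj _ _ (phi _ _ _) = 0) ?add0r //; apply/af_coker_ker; exists u.
Defined.

(** When [phi] is injective on the terms, S X -> T X -> Coker is a short exact sequence of
    complexes, so the cone of its first map resolves the cokernel. *)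
Lemma ancone_coker_quasi_iso X :
  (forall n x u, phi (X n) x u = 0 -> u = 0) -> @quasi_iso K D _ _ (ancone_coker X).
Proof.
move=> inj n x; split=> [[a b] [da db] [w]|w dw].
  have [b' <-] := af_coker_surj w; rewrite /= af_coker_mapE => /eqP.
  rewrite -subr_eq0 -linearB => /eqP/af_coker_ker[a' ea].
  have eb : b = phi (X (n + 1)) x a' + afmap T (cdiff X n) x b' by rewrite ea subrK.
  exists (a', b'); rewrite eb; congr (_, _); apply/eqP.
  rewrite -addr_eq0; apply/eqP; apply: inj; rewrite linearD /=.
  move: db; rewrite eb linearD /= -an_nat => <-; congr (_ + _).
  rewrite -[LHS]addr0; congr (_ + _); apply/esym.
  exact: (@cdiffK K D (af_complex T X) n x b').
have [b eb] := af_coker_surj w; subst w.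
move: dw; rewrite /= af_coker_mapE => /af_coker_ker[a ea].
exists (- a, b), 0; split; last by rewrite linear0 addr0.
congr (_, _) => /=; last by rewrite mhN ea addNr.
rewrite mhN opprK; apply: inj; rewrite an_nat ea.
exact: (@cdiffK K D (af_complex T X) (n + 1) x b).
Qed.

End ConeFunctor.

(** * Modules over the one-point extension *)

Section KCatLinear.
Variables (K : fieldType) (C : kcat K).

Lemma kcomp0l (x y z : C) (f : khom C x y) : kcomp (0 : khom C y z) f = 0.
Proof. exact: lin_zero ((kcomp_bilin _ _ _).1 f). Qed.

Lemma kcomp0r (x y z : C) (g : khom C y z) : kcomp g (0 : khom C x y) = 0.
Proof. exact: lin_zero ((kcomp_bilin _ _ _).2 g). Qed.

Lemma mact0 (F : kmodule C) x y (v : F x) : mact F (0 : khom C x y) v = 0.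
Proof. exact: lin_zero (mact_hom_lin v). Qed.

Lemma mact0r (F : kmodule C) x y (f : khom C x y) : mact F f 0 = 0.
Proof. exact: linear0. Qed.

End KCatLinear.

(** * Point part, [U]-part and pairing of a module over the extension *)

Section OnePoint.
Variables (K : fieldType) (U : kcat K) (M : kmodule U).
Notation L := (one_point_extension M).

Definition lam (x y : L) (t : K) (n : M y.2) (u : khom U x.2 y.2) : khom L x y :=
  (t, n, u).

Lemma lam_eta (x y : L) (f : khom L x y) : f = lam f.1.1 f.1.2 f.2.
Proof. by case: f => [[t n] u]. Qed.

Lemma lam_id (x : L) : kid x = lam 1 0 (kid x.2).
Proof. by []. Qed.

Lemma lam_lin (x y : L) a t t' n n' (u u' : khom U x.2 y.2) :
  lam (a * t + t') (a *: n + n') (a *: u + u') = a *: lam t n u + lam t' n' u'.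
Proof. by []. Qed.

Lemma lam_comp (x y z : L) t' (n' : M z.2) (u' : khom U y.2 z.2) t n (u : khom U x.2 y.2) :
  kcomp (lam t' n' u') (lam t n u)
  = lam (t' * t) (t *: n' + mact M u' n) (kcomp u' u).
Proof.
congr (_, _, _); rewrite /tri_actr /tri_actl /=; congr (_ + _).
  rewrite kone_tens_mapE /= -{2}(mact_id n'); have h := mact_hom_lin n' t (kid _) 0.
  by rewrite addr0 mact0 addr0 in h.
by rewrite kone_tens_mapE scale1r.
Qed.

Section Module.
Variable F : kmodule L.

Definition act (x y : L) t n u (v : F x) : F y := mact F (lam t n u) v.

Lemma act_linear x y t n u : linear (@act x y t n u).
Proof. exact: mact_lin. Qed.

HB.instance Definition _ x y t n u :=
  GRing.isLinear.Build K (F x) (F y) *:%R (@act x y t n u) (@act_linear x y t n u).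

Lemma actD x y t n u (v w : F x) : @act x y t n u (v + w) = act t n u v + act t n u w.
Proof. exact: linearD. Qed.

Lemma mact_act x y (f : khom L x y) v : mact F f v = @act x y f.1.1 f.1.2 f.2 v.
Proof. by rewrite [f in LHS]lam_eta. Qed.

Lemma act_comp x y z t' n' u' t n u (v : F x) :
  @act y z t' n' u' (@act x y t n u v)
  = @act x z (t' * t) (t *: n' + mact M u' n) (kcomp u' u) v.
Proof. by rewrite /act -mact_comp lam_comp. Qed.

Lemma act_id x v : @act x x 1 0 (kid x.2) v = v.
Proof. by rewrite /act -lam_id mact_id. Qed.

Lemma act_lin x y a t t' n n' u u' (v : F x) :
  @act x y (a * t + t') (a *: n + n') (a *: u + u') v
  = a *: @act x y t n u v + @act x y t' n' u' v.
Proof. by rewrite /act lam_lin mact_hom_lin. Qed.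

Lemma act_split x y t n u (v : F x) :
  @act x y t n u v = t *: @act x y 1 0 0 v + @act x y 0 n 0 v + @act x y 0 0 u v.
Proof.
have e1 := @act_lin x y t 1 0 0 n 0 u v; have e2 := @act_lin x y 1 0 0 n 0 0 u v.
rewrite -addrA; rewrite !scaler0 !add0r mulr1 addr0 in e1.
by rewrite !scale1r mulr0 !add0r addr0 in e2; rewrite e1 e2.
Qed.

Lemma act0 x y (v : F x) : @act x y 0 0 0 v = 0.
Proof. exact: (mact0 y v). Qed.

End Module.

Lemma modhom_act F G (f : modhom F G) (x y : L) t n u (v : F x) :
  f y (act t n u v) = act t n u (f x v).
Proof. exact: mh_nat. Qed.

Let actE := (act_comp, mul0r, mulr0, mul1r, mulr1, scale0r, scale1r, scaler0,
  kcomp0l, kcomp0r, kcomp1l, kcomp1r, mact0, mact0r, add0r, addr0, act0).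

Section Parts.
Variable F : kmodule L.

(* With e1 = (1, 0, 0) and e2 = (0, 0, 1) in the endomorphisms of x, these are   *)
(* the summands e1 F x = Ker e2 and e2 F x = Ker e1 of F x.                     *)
Definition ptpart (x : L) : lmodType K := kersp (@act F x x 0 0 (kid x.2)).
Definition upart (x : U) : lmodType K := kersp (@act F (tt, x) (tt, x) 1 0 0).

Lemma ptpartE x y t n u (v : ptpart x) :
  @act F x y t n u (val v) = t *: act 1 0 0 (val v) + act 0 n 0 (val v).
Proof.
rewrite act_split; have := kerspP v => /= e.
have -> : @act F x y 0 0 u (val v) = act 0 0 u (act 0 0 (kid x.2) (val v)).
  by rewrite !actE.
by rewrite e linear0 addr0.
Qed.

Lemma ptpart_id x (v : ptpart x) : @act F x x 1 0 0 (val v) = val v.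
Proof. by rewrite -[RHS]act_id [RHS]ptpartE !actE. Qed.

Lemma upartE (x : U) (y : L) t n u (v : upart x) :
  @act F (tt, x) y t n u (val v) = act 0 0 u (val v).
Proof.
rewrite act_split; have := kerspP v => /= e.
have h t' n' : @act F (tt, x) y t' n' 0 (val v) = act t' n' 0 (@act F (tt, x) (tt, x) 1 0 0 (val v)).
  by rewrite !actE.
by rewrite (h 1 0) (h 0 n) e !linear0 ?scaler0 !add0r.
Qed.

Lemma upart_id (x : U) (v : upart x) :
  @act F (tt, x) (tt, x) 0 0 (kid x) (val v) = val v.
Proof. by rewrite -[RHS]act_id [RHS]upartE. Qed.

Lemma act_pt x y (v : F x) : @act F y y 0 0 (kid y.2) (@act F x y 1 0 0 v) = 0.
Proof. by rewrite !actE. Qed.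

Definition topt x y (v : F x) : ptpart y := inker (act_pt y v).

Lemma topt_linear x y : linear (@topt x y).
Proof. by move=> a v w; apply: val_inj; rewrite /= linearP. Qed.

HB.instance Definition _ x y :=
  GRing.isLinear.Build K (F x) (ptpart y) *:%R (@topt x y) (@topt_linear x y).

Lemma topt_id x (v : ptpart x) : topt x (val v) = v.
Proof. by apply: val_inj; rewrite /= ptpart_id. Qed.

(** The morphism (1, 0, 0) identifies the point parts at all objects with a single vector space V;
    these are the identifications. *)
Definition pttr x y (v : ptpart x) : ptpart y := topt y (val v).

Lemma pttr_linear x y : linear (@pttr x y).
Proof. by move=> a v w; apply: val_inj; rewrite /= linearP. Qed.

HB.instance Definition _ x y :=
  GRing.isLinear.Build K (ptpart x) (ptpart y) *:%R (@pttr x y) (@pttr_linear x y).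

Lemma pttr_id x (v : ptpart x) : pttr x v = v.
Proof. exact: topt_id. Qed.

Lemma pttr_comp x y z (v : ptpart x) : pttr z (pttr y v) = pttr z v.
Proof. by apply: val_inj; rewrite /= !actE. Qed.

Lemma act_u (x : L) (y : U) u (v : F x) :
  @act F (tt, y) (tt, y) 1 0 0 (@act F x (tt, y) 0 0 u v) = 0.
Proof. by rewrite !actE. Qed.

Definition tou (x : L) (y : U) (u : khom U x.2 y) (v : F x) : upart y :=
  inker (act_u u v).

Lemma tou_linear x y u : linear (@tou x y u).
Proof. by move=> a v w; apply: val_inj; rewrite /= linearP. Qed.

HB.instance Definition _ x y u :=
  GRing.isLinear.Build K (F x) (upart y) *:%R (@tou x y u) (@tou_linear x y u).

Lemma tou_id (x : U) (v : upart x) : tou (x := (tt, x)) (kid x) (val v) = v.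
Proof. by apply: val_inj; rewrite /= upart_id. Qed.

Definition tensM (x : L) : lmodType K := tensor (ptpart x) (M x.2).

Definition tensM_tr (x y : L) (u : khom U x.2 y.2) : tensM x -> tensM y :=
  tens_map (@pttr x y) (mact M u).

HB.instance Definition _ x y u := GRing.Linear.copy (@tensM_tr x y u)
  (tens_map (@pttr x y) (mact M u)).

Lemma pairing_bilin x : bilin (fun (v : ptpart x) (m : M x.2) =>
  @act F x x 0 m 0 (val v)).
Proof.
split=> [m a v w|v a m m']; first by rewrite linearP.
by rewrite -act_lin mulr0 scaler0 !addr0.
Qed.

(** The structure map phi : V (x) M -> F, with values in all of [F x]; [act_pairing] shows that they
    lie in the [U]-part. *)
Definition pairing x : tensM x -> F x :=
  tens_lift (fun v m => @act F x x 0 m 0 (val v)).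

Lemma pairing_linear x : linear (@pairing x).
Proof. exact: tens_lift_linear (@pairing_bilin x). Qed.

HB.instance Definition _ x :=
  GRing.isLinear.Build K (tensM x) (F x) *:%R (@pairing x) (@pairing_linear x).

Lemma pairing_tens x (v : ptpart x) m : pairing (tens v m) = @act F x x 0 m 0 (val v).
Proof. exact: tens_lift_tens (@pairing_bilin x). Qed.

Lemma act_pairing x y t n u (a : tensM x) :
  @act F x y t n u (pairing a) = pairing (tensM_tr u a).
Proof.
apply: (@tens_linear_ext _ _ _ _ (act t n u \o @pairing x) (@pairing y \o tensM_tr u)).
by move=> v m /=; rewrite /tensM_tr tens_mapE !pairing_tens /= !actE.
Qed.

Lemma tensM_tr_id x (a : tensM x) : tensM_tr (kid x.2) a = a.
Proof. by apply: tens_map_id => [v|m]; [exact: pttr_id | exact: mact_id]. Qed.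

Lemma tensM_tr_comp x y z (u' : khom U y.2 z.2) (u : khom U x.2 y.2) (a : tensM x) :
  @tensM_tr y z u' (tensM_tr u a) = @tensM_tr x z (kcomp u' u) a.
Proof.
apply: tens_map_comp => [v|m]; [exact: pttr_comp | by rewrite /= mact_comp].
Qed.

Lemma tensM_tr_comb x y c (u u' : khom U x.2 y.2) (a : tensM x) :
  @tensM_tr x y (c *: u + u') a = c *: tensM_tr u a + tensM_tr u' a.
Proof. by apply: tens_map_combr => m; exact: mact_hom_lin. Qed.

End Parts.

Section PartMaps.
Variables (F G : kmodule L) (f : modhom F G).

Definition ptmap x (v : ptpart F x) : ptpart G x := topt x (f x (val v)).

Lemma ptmap_linear x : linear (@ptmap x).
Proof. by move=> a v w; apply: val_inj; rewrite /= !linearP. Qed.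

HB.instance Definition _ x :=
  GRing.isLinear.Build K (ptpart F x) (ptpart G x) *:%R (@ptmap x) (@ptmap_linear x).

Lemma ptmapE x (v : ptpart F x) : val (ptmap v) = f x (val v).
Proof. by rewrite /= -modhom_act ptpart_id. Qed.

Lemma pttr_map x y (v : ptpart F x) : pttr y (ptmap v) = ptmap (pttr y v).
Proof. by apply: val_inj; rewrite ptmapE /= -!modhom_act !actE. Qed.

Definition upmap x (v : upart F x) : upart G x := tou (x := (tt, x)) (kid x) (f (tt, x) (val v)).

Lemma upmap_linear x : linear (@upmap x).
Proof. by move=> a v w; apply: val_inj; rewrite /= !linearP. Qed.

HB.instance Definition _ x :=
  GRing.isLinear.Build K (upart F x) (upart G x) *:%R (@upmap x) (@upmap_linear x).

Lemma upmapE x (v : upart F x) : val (upmap v) = f (tt, x) (val v).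
Proof. by rewrite /= -modhom_act upart_id. Qed.

Definition tensM_map x : tensM F x -> tensM G x :=
  tens_map (@ptmap x) (idfun : {linear M x.2 -> M x.2}).

HB.instance Definition _ x := GRing.Linear.copy (@tensM_map x)
  (tens_map (@ptmap x) (idfun : {linear M x.2 -> M x.2})).

Lemma tensM_map_tr x y (u : khom U x.2 y.2) (a : tensM F x) :
  tensM_map (@tensM_tr F x y u a) = tensM_tr u (tensM_map a).
Proof.
rewrite /tensM_map /tensM_tr.
rewrite (tens_map_comp (h := @ptmap y \o pttr y) (k := mact M u)) //.
by apply/esym/tens_map_comp => v //=; exact: pttr_map.
Qed.

Lemma pairing_map x (a : tensM F x) : pairing (tensM_map a) = f x (pairing a).
Proof.
apply: (@tens_linear_ext _ _ _ _ (@pairing G x \o @tensM_map x) (f x \o @pairing F x)).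
by move=> v m /=; rewrite /tensM_map tens_mapE !pairing_tens ptmapE modhom_act.
Qed.

End PartMaps.

Lemma tensM_map_id F x (a : tensM F x) : tensM_map (modhom_id F) a = a.
Proof. by apply: tens_map_id => // v; apply: val_inj; rewrite ptmapE. Qed.

Lemma tensM_map_comp F G H (g : modhom G H) (f : modhom F G) x (a : tensM F x) :
  tensM_map (modhom_comp g f) a = tensM_map g (tensM_map f a).
Proof.
by apply/esym/tens_map_comp => // v; apply: val_inj; rewrite !ptmapE.
Qed.

Lemma tensM_map_add F G (f g : modhom F G) x (a : tensM F x) :
  tensM_map (modhom_add f g) a = tensM_map f a + tensM_map g a.
Proof.
rewrite -[tensM_map f a]scale1r; apply: tens_map_combl => v.
apply: val_inj; apply: etrans (ptmapE _ _) _.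
by rewrite scale1r raddfD; congr (_ + _); apply/esym/ptmapE.
Qed.

End OnePoint.

(** * Functors between modules over [U] and over the extension *)

Section OnePointModules.
Variables (K : fieldType) (U : kcat K) (M : kmodule U).
Notation L := (one_point_extension M).
Let actE := (act_comp, mul0r, mulr0, mul1r, mulr1, scale0r, scale1r, scaler0,
  kcomp0l, kcomp0r, kcomp1l, kcomp1r, mact0, mact0r, add0r, addr0, act0).

Definition tensM_mod (F : kmodule L) : kmodule U.
Proof.
refine (@KModule K U (fun x => tensM F (tt, x))
  (fun x y f => @tensM_tr K U M F (tt, x) (tt, y) f) _ _ _ _).
- by move=> x y f; exact: linearP.
- by move=> x y a c u u'; exact: tensM_tr_comb.
- by move=> x a; exact: tensM_tr_id.
- by move=> x y z g f a; rewrite tensM_tr_comp.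
Defined.

Definition tensM_modmap F G (f : modhom F G) : modhom (tensM_mod F) (tensM_mod G).
Proof.
refine (@ModHom K U (tensM_mod F) (tensM_mod G)
  (fun x => @tensM_map K U M F G f (tt, x)) _ _).
- by move=> x; exact: (linearP (@tensM_map K U M F G f (tt, x))).
- by move=> x y u a; exact: tensM_map_tr.
Defined.

Definition tensM_af : afunctor L U.
Proof.
refine (@AFunctor K L U tensM_mod tensM_modmap _ _ _).
- by move=> F x a; exact: tensM_map_id.
- by move=> F G H g f x a; exact: tensM_map_comp.
- by move=> F G f g x a; exact: tensM_map_add.
Defined.

Definition upart_mod (F : kmodule L) : kmodule U.
Proof.
refine (@KModule K U (upart F)
  (fun x y f v => @tou K U M F (tt, x) y f (val v)) _ _ _ _).
- by move=> x y f a v w; rewrite -linearP.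
- move=> x y v a f g; apply: val_inj; rewrite /=.
  by rewrite -act_lin mulr0 scaler0 !addr0.
- by move=> x v; exact: tou_id.
- by move=> x y z g f v; apply: val_inj; rewrite /= !actE.
Defined.

Definition upart_modmap F G (f : modhom F G) : modhom (upart_mod F) (upart_mod G).
Proof.
refine (@ModHom K U (upart_mod F) (upart_mod G) (fun x => @upmap K U M F G f x) _ _).
- by move=> x; exact: (linearP (@upmap K U M F G f x)).
- move=> x y u v; apply: val_inj; rewrite upmapE.
  rewrite -[RHS]/(@act K U M G (tt, x) (tt, y) 0 0 u (val (upmap f v))) upmapE.
  exact: modhom_act.
Defined.

Definition upart_af : afunctor L U.
Proof.
refine (@AFunctor K L U upart_mod upart_modmap _ _ _).
- by move=> F x v; apply: val_inj; rewrite upmapE.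
- by move=> F G H g f x v; apply: val_inj; rewrite !upmapE.
- move=> F G f g x v; apply: val_inj; apply: etrans (upmapE _ _) _.
  by rewrite raddfD; congr (_ + _); apply/esym/upmapE.
Defined.

Definition pairing_mod F : modhom (tensM_mod F) (upart_mod F).
Proof.
refine (@ModHom K U (tensM_mod F) (upart_mod F)
  (fun x a => @tou K U M F (tt, x) x (kid x) (pairing a)) _ _).
- by move=> x a v w; rewrite -!linearP.
- by move=> x y f a; apply: val_inj; rewrite /= !act_pairing !tensM_tr_id.
Defined.

Definition pairing_an : afnat tensM_af upart_af.
Proof.
refine (@AFNat K L U tensM_af upart_af pairing_mod _).
- by move=> F G f x a; apply: val_inj; rewrite upmapE /= !act_pairing !tensM_tr_id pairing_map.
Defined.

Lemma pairing_anE F x (a : tensM_mod F x) :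
  val (pairing_an F x a : upart F x) = @pairing K U M F (tt, x) a.
Proof. by rewrite /= act_pairing tensM_tr_id. Qed.

Definition lam_proj : kfunctor L U.
Proof.
refine (@KFunctor K L U snd (fun x y f => f.2) _ _ _).
- by [].
- by [].
- by [].
Defined.

(** The module (0, N) is the restriction of N along [lam_proj], so that the entries t and n of a
    matrix act by zero. *)
Definition extend_af : afunctor U L :=
  @AFunctor K U L (fun N => mod_precomp N lam_proj)
    (fun F G f => @ModHom K L (mod_precomp F lam_proj) (mod_precomp G lam_proj)
       (fun x => f x.2) (fun x => mh_lin f (x := x.2)) (fun x y k v => mh_nat f k.2 v))
    (fun _ _ _ => erefl) (fun _ _ _ _ _ _ _ => erefl) (fun _ _ _ _ _ _ => erefl).

(* The triple (V, V (x) M, id), where F is (V, F, phi). Indexing V by the        *)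
(* objects of L avoids choosing one.                                            *)
Definition ptcover_mod (F : kmodule L) : kmodule L.
Proof.
refine (@KModule K L (fun x => (ptpart F x * tensM F x)%type)
  (fun x y f p => (f.1.1 *: pttr y p.1,
     tens (pttr y p.1) f.1.2 + tensM_tr f.2 p.2)) _ _ _ _).
- move=> x y [[t n] u] a [v b] [w c]; congr (_, _) => /=.
    by rewrite linearP scalerDr !scalerA mulrC.
  by rewrite !linearP (tens_bilin _ _).1 scalerDr addrACA.
- move=> x y [v b] a [[t n] u] [[t' n'] u']; congr (_, _) => /=.
    by rewrite scalerDl scalerA.
  by rewrite (tens_bilin _ _).2 tensM_tr_comb scalerDr addrACA.
- move=> x [v b]; congr (_, _) => /=; first by rewrite pttr_id scale1r.
  by rewrite (lin_zero ((tens_bilin _ _).2 _)) add0r tensM_tr_id.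
- move=> x y z [[t' n'] u'] [[t n] u] [v b]; rewrite lam_comp; congr (_, _) => /=.
    by rewrite linearZ /= pttr_comp scalerA.
  rewrite linearZ /= pttr_comp linearD /= tensM_tr_comp addrA; congr (_ + _).
  rewrite /tensM_tr tens_mapE /= pttr_comp (tens_bilin _ _).2.
  by rewrite (lin_scale ((tens_bilin _ _).1 _)).
Defined.

Definition ptcover_modmap F G (f : modhom F G) : modhom (ptcover_mod F) (ptcover_mod G).
Proof.
refine (@ModHom K L (ptcover_mod F) (ptcover_mod G)
  (fun x p => (ptmap f p.1, tensM_map f p.2)) _ _).
- by move=> x a [v b] [w c]; rewrite /= !linearP.
- move=> x y [[t n] u] [v b]; congr (_, _) => /=.
    by rewrite linearZ /= pttr_map.
  rewrite linearD /= tensM_map_tr; congr (_ + _).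
  by rewrite /tensM_map tens_mapE pttr_map.
Defined.

Definition ptcover_af : afunctor L L.
Proof.
refine (@AFunctor K L L ptcover_mod ptcover_modmap _ _ _).
- move=> F x [v b]; congr (_, _); last exact: tensM_map_id.
  by apply: val_inj; rewrite ptmapE.
- move=> F G H g f x [v b]; congr (_, _); last exact: tensM_map_comp.
  by apply: val_inj; rewrite !ptmapE.
- move=> F G f g x [v b]; congr (_, _); last exact: tensM_map_add.
  apply: val_inj; apply: etrans (ptmapE _ _) _.
  by rewrite raddfD; congr (_ + _); apply/esym/ptmapE.
Defined.

Definition id_af (C : kcat K) : afunctor C C :=
  @AFunctor K C C id (fun _ _ f => f) (fun _ _ _ => erefl)
    (fun _ _ _ _ _ _ _ => erefl) (fun _ _ _ _ _ _ => erefl).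

Lemma act_counit F (x y : L) t n u (v : ptpart F x) (b : tensM F x) :
  @act K U M F x y t n u (val v + pairing b)
  = t *: @act K U M F x y 1 0 0 (val v) + @act K U M F x y 0 n 0 (val v)
    + pairing (tensM_tr u b).
Proof. by rewrite linearD /= ptpartE act_pairing. Qed.

Definition ptcover_counit F : modhom (ptcover_mod F) F.
Proof.
refine (@ModHom K L (ptcover_mod F) F (fun x p => val p.1 + pairing p.2) _ _).
- by move=> x a [v b] [w c]; rewrite /= !linearP scalerDr addrACA.
- move=> x y [[t n] u] [v b].
  rewrite [RHS]mact_act; apply: etrans (esym (act_counit _ _ _ _ _)); rewrite -addrA; congr (_ + _).
  rewrite [LHS]linearD; congr (_ + _); apply: etrans (pairing_tens _ _) _.
  by rewrite /= !actE.
Defined.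

Definition ptcover_an : afnat ptcover_af (id_af L).
Proof.
refine (@AFNat K L L ptcover_af (id_af L) ptcover_counit _).
- move=> F G f x [v b]; rewrite /= mhD pairing_map; congr (_ + _); exact: ptmapE.
Defined.

(** The idempotent (1, 0, 0) moves a preimage in [F] into the point part, so taking point parts is
    exact; flatness over a field does the rest. *)
Lemma tensM_af_exact : af_exact tensM_af.
Proof.
move=> F G H f g ex x; apply: tens_map_exact => v /(congr1 val) e.
have [|u eu] := ex _ (val v); first by rewrite -ptmapE e.
exists (topt (tt, x) u); apply: val_inj.
by rewrite ptmapE /= modhom_act -eu ptpart_id.
Qed.

Lemma upart_af_exact : af_exact upart_af.
Proof.
move=> F G H f g ex x v /(congr1 val) e.
have [|u eu] := ex _ (val v); first by rewrite -upmapE e.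
exists (@tou K U M F (tt, x) x (kid x) u); apply: val_inj.
by rewrite upmapE /= modhom_act -eu upart_id.
Qed.

Lemma extend_af_exact : af_exact extend_af.
Proof. by move=> F G H f g ex x v; exact: ex. Qed.

(** Maps from (V, V (x) M, id) to [X] amount to linear maps from V to the point part of [X], and
    these lift along surjections of vector spaces. *)
Lemma ptcover_projective F : @projective (Mod L) (ptcover_af F).
Proof.
move=> X Y g /epi_mod_surj gs f.
(* Linear maps out of V are handled at one object [x0]; if there is no object, every map is given
   vacuously. *)
have [[x0]|nL] := pselect (inhabited L); last first.
  pose h x := False_rect (ptcover_mod F x -> X x) (nL (inhabits x)).
  have h1 x : linear (h x) by case: (nL (inhabits x)).
  have h2 x y (k : khom L x y) v : h y (mact (ptcover_mod F) k v) = mact X k (h x v).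
    by case: (nL (inhabits x)).
  by exists (@ModHom K L _ _ h h1 h2) => x; case: (nL (inhabits x)).
have [s [sl sK]] := linear_section (@mh_lin _ _ _ _ g x0) (gs x0).
(* The lift [l] may have a component in the [U]-part. It does no harm: [l] is only used followed by
   (1, 0, 0) or (0, m, 0), which kill that part. *)
pose l (v : ptpart F x0) : X x0 := s (f x0 (v, 0)).
have l_lin : linear l.
  move=> a v w; rewrite /l -sl; congr s; rewrite -linearP; congr (f x0 _).
  by congr (_, _); rewrite /= scaler0 addr0.
have gl v : g x0 (l v) = f x0 (v, 0) by rewrite /l sK.
pose lf : {linear _ -> _} := HB.pack l (GRing.isLinear.Build _ _ _ _ l l_lin).
have b_bilin x : bilin (fun v m => @act K U M X x0 x 0 m 0 (l (pttr x0 (v : ptpart F x)))).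
  split=> [m a v w|v a m m'].
    by rewrite -[l]/(lf : _ -> _) !linearP.
  by rewrite -act_lin mulr0 scaler0 !addr0.
pose k x : tensM F x -> X x := tens_lift (fun v m =>
  @act K U M X x0 x 0 m 0 (l (pttr x0 (v : ptpart F x)))).
have k_lin x : linear (k x) by exact: tens_lift_linear (b_bilin x).
have kE x v m : k x (tens v m) = @act K U M X x0 x 0 m 0 (l (pttr x0 v)).
  exact: tens_lift_tens (b_bilin x).
pose h x (p : ptcover_mod F x) : X x :=
  @act K U M X x0 x 1 0 0 (l (pttr x0 p.1)) + k x p.2.
have h1 x : linear (h x).
  move=> a [v b] [w c]; rewrite /h /= k_lin -[l]/(lf : _ -> _) !linearP.
  by rewrite scalerDr addrACA.
have k_act x y t n u b : @act K U M X x y t n u (k x b) = k y (tensM_tr u b).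
  pose kx : {linear tensM F x -> X x} := HB.pack (k x) (GRing.isLinear.Build _ _ _ _ _ (k_lin x)).
  pose ky : {linear tensM F y -> X y} := HB.pack (k y) (GRing.isLinear.Build _ _ _ _ _ (k_lin y)).
  apply: (@tens_linear_ext _ _ _ _ (act t n u \o kx) (ky \o tensM_tr u)) => v m /=.
  by rewrite /tensM_tr tens_mapE !kE /= !actE pttr_comp.
have h_act x y t n u v b : @act K U M X x y t n u (h x (v, b))
    = t *: @act K U M X x0 y 1 0 0 (l (pttr x0 v))
      + @act K U M X x0 y 0 n 0 (l (pttr x0 v)) + k y (tensM_tr u b).
  rewrite /h linearD /= k_act; congr (_ + _).
  by rewrite act_comp !actE act_split !actE.
have h2 x y (q : khom L x y) v : h y (mact (ptcover_mod F) q v) = mact X q (h x v).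
  case: q v => [[t n] u] [v b].
  rewrite [RHS]mact_act; apply: etrans (esym (h_act _ _ _ _ _ _ _)).
  rewrite /h -addrA; congr (_ + _) => /=.
    by rewrite -[l]/(lf : _ -> _) !linearZ /= pttr_comp.
  rewrite -[tens _ _]scale1r k_lin scale1r; congr (_ + _).
  by apply: etrans (kE _ _ _) _; rewrite pttr_comp.
exists (@ModHom K L _ _ h h1 h2) => x [v b].
rewrite /= /h /= mhD modhom_act gl.
have fE w : f x w = f x (w.1, 0) + f x (0, w.2).
  by rewrite -mhD; congr (f x _); case: w => w1 w2; congr (_, _); rewrite /= ?addr0 ?add0r.
rewrite [RHS]fE /=; congr (_ + _).
  rewrite -modhom_act; congr (f x _); rewrite /act; congr (_, _) => /=.
    by rewrite scale1r pttr_comp pttr_id.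
  by rewrite linear0 addr0 (lin_zero ((tens_bilin _ _).2 _)).
pose kx : {linear tensM F x -> X x} := HB.pack (k x) (GRing.isLinear.Build _ _ _ _ _ (k_lin x)).
have f0_lin : linear (fun c : tensM F x => f x (0, c)).
  move=> a c d; rewrite -linearP; congr (f x _).
  by congr (_, _); rewrite /= scaler0 addr0.
pose fx : {linear tensM F x -> Y x} := HB.pack (fun c : tensM F x => f x (0, c))
  (GRing.isLinear.Build _ _ _ _ _ f0_lin).
apply: (@tens_linear_ext _ _ _ _ (g x \o kx) fx) => {}v m /=.
rewrite kE modhom_act gl -modhom_act; congr (f x _); rewrite /act; congr (_, _) => /=.
  by rewrite scale0r.
by rewrite linear0 addr0 pttr_comp pttr_id.
Qed.

(** [extend_af] is left adjoint to the exact functor [upart_af]: a map out of (0, N) is transposed,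
    lifted between [U]-modules, and transposed back. *)
Lemma extend_projective N :
  @projective (Mod U) N -> @projective (Mod L) (extend_af N).
Proof.
move=> hN X Y g /epi_mod_surj gs f.
pose f0 x (v : N x) : upart_mod Y x := @tou K U M Y (tt, x) x (kid x) (f (tt, x) v).
have f0E x v : val (f0 x v : upart Y x) = f (tt, x) v.
  by rewrite /= -modhom_act; congr (f _ _); exact: mact_id.
have f0_lin x : linear (f0 x).
  by move=> a v w; apply: val_inj; rewrite /= !linearP.
have f0_nat x y (u : khom U x y) v : f0 y (mact N u v) = mact (upart_mod Y) u (f0 x v).
  apply: val_inj; rewrite f0E.
  rewrite -[RHS]/(@act K U M Y (tt, x) (tt, y) 0 0 u (val (f0 x v : upart Y x))) f0E.
  exact: (mh_nat f (@lam K U M (tt, x) (tt, y) 0 0 u) v).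
have [|h hE] := @proj_lift _ _ N _ _ (upart_modmap g) (@ModHom K U _ _ f0 f0_lin f0_nat) hN.
  move=> x w; have [u eu] := gs (tt, x) (val (w : upart Y x)).
  exists (@tou K U M X (tt, x) x (kid x) u); apply: val_inj.
  by rewrite upmapE /= modhom_act eu upart_id.
have {}hE x v : g (tt, x) (val (h x v : upart X x)) = f (tt, x) v.
  by rewrite -f0E -upmapE; congr val; exact: hE.
pose h' x (v : extend_af N x) : X x :=
  @act K U M X (tt, x.2) x 0 0 (kid x.2) (val (h x.2 v : upart X x.2)).
have h1 x : linear (h' x) by move=> a v w; rewrite /h' !linearP.
have h2 x y (q : khom L x y) v : h' y (mact (extend_af N) q v) = mact X q (h' x v).
  case: q => [[t n] u]; rewrite [RHS]mact_act /h'.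
  rewrite -[mact (extend_af N) _ v]/(mact N u v) mh_nat.
  by rewrite /= !actE.
exists (@ModHom K L _ _ h' h1 h2) => x v /=.
rewrite /h' modhom_act hE -modhom_act; congr (f x _); exact: mact_id.
Qed.

Definition upart_counit F : modhom (extend_af (upart_af F)) F.
Proof.
refine (@ModHom K L (extend_af (upart_af F)) F
  (fun x v => @act K U M F (tt, x.2) x 0 0 (kid x.2) (val (v : upart F x.2))) _ _).
- by move=> x a v w; rewrite !linearP.
- by move=> x y [[t n] u] v; rewrite [RHS]mact_act /= !actE.
Defined.

Definition tensM_counit F : modhom (extend_af (tensM_af F)) (ptcover_af F).
Proof.
refine (@ModHom K L (extend_af (tensM_af F)) (ptcover_af F)
  (fun x a => (0, @tensM_tr K U M F (tt, x.2) x (kid x.2) a)) _ _).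
- by move=> x a v w; congr (_, _); rewrite /= ?scaler0 ?addr0 // linearP.
- move=> x y [[t n] u] v; congr (_, _); rewrite /= linear0 ?scaler0 //.
  rewrite (lin_zero ((tens_bilin _ _).1 _)) add0r !tensM_tr_comp.
  by rewrite kcomp1l kcomp1r.
Defined.

Lemma act_pt_u (F : kmodule L) (x : L) (v : F x) :
  @act K U M F x x 1 0 0 v + @act K U M F x x 0 0 (kid x.2) v = v.
Proof. by rewrite -[RHS]act_id [RHS]act_split scale1r !actE. Qed.

(* F is a direct summand of (V, V (x) M, id) + (0, F), and the V (x) M component *)
(* of the inclusion is a retraction of the pairing.                             *)
Lemma pairing_inj F : @projective (Mod L) F ->
  forall x a, pairing_an F x a = 0 -> a = 0.
Proof.
move=> hF.
pose r := modhom_add (modhom_comp (ptcover_an F) (modpr1 (ptcover_af F) (extend_af (upart_af F))))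
  (modhom_comp (upart_counit F) (modpr2 _ _)).
have [|s sK] := @proj_lift _ _ F _ _ r (modhom_id F) hF.
  move=> [[] x] w; exists ((topt (tt, x) w, 0), @tou K U M F (tt, x) x (kid x) w).
  rewrite /= linear0 addr0 -[RHS]act_pt_u; congr (_ + _).
  by rewrite !actE.
move=> x a /(congr1 val); rewrite pairing_anE => pa.
have tr0 (b : tensM F (tt, x)) : @tensM_tr K U M F (tt, x) (tt, x) 0 b = 0.
  have := @tensM_tr_comb K U M F (tt, x) (tt, x) (-1) 0 0 b.
  by rewrite scaler0 addr0 scaleN1r addNr.
(* The idempotent (1, 0, 0) kills the pairing and the [U]-part, so that [s] being a section of [r]
   makes its V-component the identity on V. *)
have key v : (s (tt, x) (val (v : ptpart F (tt, x)))).1.1 = v.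
  have := sK (tt, x) (val v); case: (s _ _) => [[v' a'] b] /=.
  move=> /(congr1 (@act K U M F (tt, x) (tt, x) 1 0 0)).
  rewrite !linearD /= act_pairing tr0 linear0 addr0 !ptpart_id.
  by rewrite !actE => e; apply: val_inj.
pose sa (b : tensM F (tt, x)) := (s (tt, x) (pairing b)).1.2.
have sa_lin : linear sa by move=> c b b'; rewrite /sa !linearP.
pose saf : {linear tensM F (tt, x) -> tensM F (tt, x)} :=
  HB.pack sa (GRing.isLinear.Build _ _ _ _ sa sa_lin).
have e : sa a = a.
  apply: (@tens_linear_ext _ _ _ _ saf idfun) => v m /=; rewrite /sa pairing_tens modhom_act.
  by rewrite /act /= tr0 addr0 key pttr_id.
by rewrite -e /sa pa linear0.
Qed.

(** The cokernel of the pairing is left adjoint to the exact functor [extend_af]. A map out of the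
    cokernel becomes a map from [F] to (0, Y), which lifts to (0, X) and descends again. *)
Lemma coker_pairing_projective F : @projective (Mod L) F ->
  @projective (Mod U) (af_coker pairing_an F).
Proof.
move=> hF X Y g /epi_mod_surj gs f.
pose q := af_coker_proj pairing_an F.
pose p x (w : F x) : Y x.2 := f x.2 (q x.2 (@tou K U M F x x.2 (kid x.2) w)).
have p_lin x : linear (p x) by move=> a v w; rewrite /p !linearP.
(* The entry [n] reaches the [U]-part only through the pairing, which vanishes in the cokernel; this
   makes [p] a map of modules. *)
have tou_act (x y : L) t n u (w : F x) : tou (kid y.2) (@act K U M F x y t n u w)
    = pairing_an F y.2 (tens (topt (tt, y.2) w) n : tensM F (tt, y.2))
      + mact (upart_mod F) u (tou (kid x.2) w).
  set A := pairing_an F y.2 _; apply: val_inj.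
  transitivity (val (A : upart F y.2)
    + @act K U M F (tt, x.2) (tt, y.2) 0 0 u (val (@tou K U M F x x.2 (kid x.2) w))); last by [].
  rewrite pairing_anE pairing_tens /= !actE act_split.
  by rewrite scale0r add0r mact_id.
have p_nat x y (k : khom L x y) w : p y (mact F k w) = mact (extend_af Y) k (p x w).
  case: k => [[t n] u]; rewrite mact_act /p tou_act !mhD.
  have -> : q y.2 (pairing_an F y.2 (tens (topt (tt, y.2) w) n : tensM F (tt, y.2))) = 0.
    by apply/af_coker_ker; eexists.
  by rewrite mh0 add0r !mh_nat.
have [|h hE] := @proj_lift _ _ F _ _ (afmap extend_af g) (@ModHom K L F (extend_af Y) p p_lin p_nat) hF.
  by move=> x w; exact: gs.
pose h' x (v : upart_mod F x) : X x := h (tt, x) (val (v : upart F x)).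
have h1 x : linear (h' x) by move=> a v w; rewrite /h' !linearP.
have h2 x y (u : khom U x y) v : h' y (mact (upart_mod F) u v) = mact X u (h' x v).
  exact: (mh_nat h (@lam K U M (tt, x) (tt, y) 0 0 u) (val v)).
have [||k kE] := factor_surj (q := q) (h := @ModHom K U _ X h' h1 h2).
- exact: af_coker_surj.
- move=> x _ /af_coker_ker [a <-] /=; rewrite /h' pairing_anE.
  (* In (0, X) the entry [m] of a matrix acts by zero, so [h] kills the image of the pairing and
     factors through the cokernel. *)
  pose ha b := h (tt, x) (@pairing K U M F (tt, x) b).
  have ha_lin : linear ha by move=> c b b'; rewrite /ha !linearP.
  pose haf : {linear tensM F (tt, x) -> X x} :=
    HB.pack ha (GRing.isLinear.Build _ _ _ _ ha ha_lin).
  apply: (@tens_linear_ext _ _ _ _ haf \0) => v m /=.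
  by rewrite /ha pairing_tens modhom_act; exact: mact0.
exists k => x z; have [w <-] := af_coker_surj z.
rewrite /= -/(q) kE /= /h'; apply: etrans (hE (tt, x) (val w)) _.
by rewrite /= /p tou_id.
Qed.

Lemma tensM_counit_map F G (f : modhom F G) x a :
  tensM_counit G x (afmap extend_af (afmap tensM_af f) x a)
  = afmap ptcover_af f x (tensM_counit F x a).
Proof.
congr (_, _); first by rewrite /= linear0.
by rewrite /= tensM_map_tr.
Qed.

Lemma upart_counit_map F G (f : modhom F G) x v :
  upart_counit G x (afmap extend_af (afmap upart_af f) x v) = f x (upart_counit F x v).
Proof. by rewrite /= !modhom_act !actE. Qed.

Lemma upart_counit_pairing F x a :
  upart_counit F x (afmap extend_af (pairing_an F) x a)
  = ptcover_an F x (tensM_counit F x a).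
Proof. by rewrite /= !act_pairing tensM_tr_id add0r. Qed.

(** One degree of the inclusion of extend Cone(phi) in Cone(psi), with [F] in degree n + 1 and [G]
    in degree n; only the point parts are missed. *)
Definition compare_hom F G :
    modhom (extend_af (modsum (tensM_af F) (upart_af G))) (modsum (ptcover_af F) G) :=
  modpair (modhom_comp (tensM_counit F) (afmap extend_af (modpr1 _ _)))
    (modhom_comp (upart_counit G) (afmap extend_af (modpr2 _ _))).

Lemma compare_homE F G (x : U) (a : tensM_af F x) (v : upart_af G x) :
  compare_hom F G (tt, x) (a, v) = ((0, a), val (v : upart G x)).
Proof.
transitivity (tensM_counit F (tt, x) a, upart_counit G (tt, x) v); first by [].
by congr ((_, _), _); [exact: tensM_tr_id | exact: upart_id].
Qed.

Lemma compare_hom_comm F F' G (d' : modhom F F') (d : modhom G F) (x : L)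
    (a : tensM_af F x.2) (v : upart_af G x.2) :
  compare_hom F' F x (- afmap tensM_af d' x.2 a, pairing_an F x.2 a + afmap upart_af d x.2 v)
  = (- afmap ptcover_af d' x (compare_hom F G x (a, v)).1,
     ptcover_an F x (compare_hom F G x (a, v)).1 + d x (compare_hom F G x (a, v)).2).
Proof.
transitivity (- tensM_counit F' x (afmap tensM_af d' x.2 a),
    upart_counit F x (pairing_an F x.2 a) + upart_counit F x (afmap upart_af d x.2 v)).
  by congr (_, _); [exact: (mhN (tensM_counit F')) | exact: (mhD (upart_counit F))].
transitivity (- afmap ptcover_af d' x (tensM_counit F x a),
    ptcover_an F x (tensM_counit F x a) + d x (upart_counit G x v)); last by [].
by rewrite -tensM_counit_map -upart_counit_pairing -upart_counit_map.
Qed.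

Section Comparison.
Variable X : bcomplex L.

Definition ancone_compare :
  chmap (af_complex extend_af (ancone pairing_an X)) (ancone ptcover_an X).
Proof.
refine (@ChMap K L (af_complex extend_af (ancone pairing_an X)) (ancone ptcover_an X)
  (fun n => compare_hom (X (n + 1)) (X n)) _).
by move=> n x [a v]; exact: compare_hom_comm.
Defined.

Lemma ancone_compareE n (x : U) (a : tensM_af (X (n + 1)) x) (v : upart_af (X n) x) :
  ancone_compare n (tt, x) (a, v) = ((0, a), val (v : upart (X n) x)).
Proof. exact: compare_homE. Qed.

End Comparison.

Section ComparisonQuasiIso.
Variable X : bcomplex L.

(** Object by object, [((w, b), y)] goes to [b] and the [U]-part of [y] by a map that commutes with
    the differentials and retracts the comparison, so boundaries go to boundaries. *)
Lemma compare_inj n (x : U) (a : tensM_af (X (n + 1 + 1)) x) (v : upart_af (X (n + 1)) x) w b y :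
  ((0, a), val (v : upart (X (n + 1)) x)) = cdiff (ancone ptcover_an X) n (tt, x) ((w, b), y) ->
  (a, v) = cdiff (ancone pairing_an X) n x (b, @tou K U M (X n) (tt, x) x (kid x) y).
Proof.
case=> _ e2 e3; congr (_, _); first exact: e2.
have {}e3 : val (v : upart (X (n + 1)) x)
  = val (w : ptpart (X (n + 1)) (tt, x)) + pairing (b : tensM (X (n + 1)) (tt, x))
    + cdiff X n (tt, x) y by exact: e3.
apply: val_inj.
transitivity (val (pairing_an (X (n + 1)) x b : upart (X (n + 1)) x)
    + val (upmap (cdiff X n) (@tou K U M (X n) (tt, x) x (kid x) y))); last by [].
rewrite pairing_anE upmapE -[LHS]upart_id e3 !actD.
rewrite [X in X + _ + _](kerspP w) add0r; congr (_ + _).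
  by apply: etrans (act_pairing _ _ _ _) _; rewrite tensM_tr_id.
by rewrite [RHS]modhom_act.
Qed.

(** Let y1 be the point part of [y]. Subtracting the boundary of [((y1, 0), 0)] leaves only the
    [U]-part of [y], and removes [w] because the point part of the cocycle equation reads w + d y1 =
    0. *)
Lemma compare_surj n (x : U) w b y :
  cdiff (ancone ptcover_an X) (n + 1) (tt, x) ((w, b), y) = 0 ->
  exists (a : ancone pairing_an X (n + 1) x) (v : ancone ptcover_an X n (tt, x)),
    cdiff (ancone pairing_an X) (n + 1) x a = 0 /\
    ((w, b), y) = ancone_compare X (n + 1) (tt, x) a + cdiff (ancone ptcover_an X) n (tt, x) v.
Proof.
case=> _ e2 e3.
have {}e3 : val (w : ptpart (X (n + 1 + 1)) (tt, x)) + pairing (b : tensM (X (n + 1 + 1)) (tt, x))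
    + cdiff X (n + 1) (tt, x) y = 0 by exact: e3.
pose u := @tou K U M (X (n + 1)) (tt, x) x (kid x) y.
exists (b, u), ((topt (tt, x) y, 0), 0); split.
  congr (_, _); first exact: e2.
  apply: val_inj.
  transitivity (val (pairing_an (X (n + 1 + 1)) x b : upart (X (n + 1 + 1)) x)
    + val (upmap (cdiff X (n + 1)) u)); first by [].
  rewrite pairing_anE upmapE [val u]/= modhom_act.
  have := congr1 (@act K U M (X (n + 1 + 1)) (tt, x) (tt, x) 0 0 (kid x)) e3.
  rewrite !actD [X in X + _ + _ = _](kerspP w) add0r.
  have := @act_pairing K U M (X (n + 1 + 1)) (tt, x) (tt, x) 0 0 (kid x) b.
  by rewrite tensM_tr_id linear0 => -> ->.
transitivity (((0, b), val u) + (((- ptmap (cdiff X (n + 1)) (topt (tt, x) y), 0),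
   val (topt (tt, x) y)) : ancone ptcover_an X (n + 1) (tt, x))); last first.
  congr (_ + _); first by rewrite ancone_compareE.
  transitivity (- ptcover_modmap (cdiff X (n + 1)) (tt, x) (topt (tt, x) y, 0),
    ptcover_an (X (n + 1)) (tt, x) (topt (tt, x) y, 0) + cdiff X n (tt, x) 0); last by [].
  have -> : ptcover_an (X (n + 1)) (tt, x) (topt (tt, x) y, 0) = val (topt (tt, x) y).
    by rewrite /= linear0 addr0.
  have -> : ptcover_modmap (cdiff X (n + 1)) (tt, x) (topt (tt, x) y, 0)
      = (ptmap (cdiff X (n + 1)) (topt (tt, x) y), 0).
    by rewrite /= linear0.
  by rewrite mh0 addr0 -[X in ((_, X), _) = _]oppr0.
have aux : w = - ptmap (cdiff X (n + 1)) (topt (tt, x) y).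
  apply: val_inj.
  transitivity (- val (ptmap (cdiff X (n + 1)) (topt (tt, x) y))); last by [].
  rewrite ptmapE [val (topt _ _)]/= modhom_act; apply/eqP; rewrite -addr_eq0; apply/eqP.
  have := congr1 (@act K U M (X (n + 1 + 1)) (tt, x) (tt, x) 1 0 0) e3.
  rewrite !actD [X in X + _ + _ = _](ptpart_id w) linear0 => <-.
  congr (_ + _); rewrite -[LHS]addr0; congr (_ + _); apply/esym.
  have := @act_pairing K U M (X (n + 1 + 1)) (tt, x) (tt, x) 1 0 0 b.
  have := @tensM_tr_comb K U M (X (n + 1 + 1)) (tt, x) (tt, x) (-1) 0 0 b.
  by rewrite scaler0 addr0 scaleN1r addNr => -> ->; rewrite linear0.
congr ((_, _), _).
- by rewrite add0r.
- by rewrite addr0.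
- by apply: etrans (esym (act_pt_u (_ : X (n + 1) (tt, x)))) _; exact: addrC.
Qed.

Lemma ancone_compare_quasi_iso : @quasi_iso K L _ _ (ancone_compare X).
Proof.
move=> n [[] x]; split=> [[a v] _ [[[w b] y]] | [[w b] y]].
  rewrite ancone_compareE => /compare_inj e.
  by exists (b, @tou K U M (X n) (tt, x) x (kid x) y).
exact: compare_surj.
Qed.

End ComparisonQuasiIso.

(** The idempotent (0, 0, 1) acts on (0, N) as the identity, so the point part, its kernel, is
    zero. *)
Lemma tensM_extend0 N x (a : tensM_af (extend_af N) x) : a = 0.
Proof.
apply: (@tens_linear_ext _ _ _ _ idfun \0) => v m /=.
have -> : v = 0; last exact: lin_zero ((tens_bilin _ _).1 m).
by apply: val_inj; rewrite /= -(kerspP v); apply/esym; exact: (mact_id (k := N)).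
Qed.

Definition upart_extend N : modhom (upart_af (extend_af N)) N.
Proof.
refine (@ModHom K U (upart_af (extend_af N)) N
  (fun x (v : upart (extend_af N) x) => val v) _ _).
- by [].
- by [].
Defined.

Definition upart_extend_inv N : modhom N (upart_af (extend_af N)).
Proof.
refine (@ModHom K U N (upart_af (extend_af N))
  (fun x v => @tou K U M (extend_af N) (tt, x) x (kid x) v) _ _).
- by move=> x a v w; rewrite linearP.
- move=> x y f v; apply: val_inj => /=; rewrite /act /= -!mact_comp ?kcomp1l ?kcomp1r.
  by [].
Defined.

Section Counit.
Variable X : bcomplex U.

Definition ancone_extend_hom n :
    modhom (ancone pairing_an (af_complex extend_af X) n) (X n) :=
  modhom_comp (upart_extend (X n)) (modpr2 _ _).

Definition ancone_extend : chmap (ancone pairing_an (af_complex extend_af X)) X.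
Proof.
refine (@ChMap K U (ancone pairing_an (af_complex extend_af X)) X ancone_extend_hom _).
move=> n x [a v].
transitivity (val (pairing_an (extend_af (X (n + 1))) x a : upart (extend_af (X (n + 1))) x)
   + val (upmap (afmap extend_af (cdiff X n)) v)); first by [].
by rewrite [a in LHS]tensM_extend0 mh0 upmapE [val 0]/= add0r.
Defined.

Definition ancone_extend_inv n :
    modhom (X n) (ancone pairing_an (af_complex extend_af X) n) :=
  modpair (modhom_zero _ _) (upart_extend_inv (X n)).

Lemma ancone_extend_iso :
  @is_iso (Kb U) (ancone pairing_an (af_complex extend_af X)) X ancone_extend.
Proof.
have [||g [_ i]] := chmap_inverse_iso (f := ancone_extend) (g := ancone_extend_inv); last exact: i.
- move=> n x [a v]; rewrite [a]tensM_extend0.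
  have e := @tou_id K U M (extend_af (X n)) x v.
  by rewrite -[in RHS]e.
- move=> n x v; exact: mact_id.
Qed.

End Counit.

End OnePointModules.

(** * Singularity categories *)

Section DerivedFunctors.
Variables (K : fieldType) (C D : kcat K).
Variable F : trifunctor (Kb C) (Kb D).
Hypothesis Fq : forall (X Y : Kb C) (f : mor X Y), quasi_iso f -> quasi_iso (fmap F f).

Definition Db_tri : trifunctor (Db C) (Db D) :=
  loc_trifunctor (@quasi_iso_shift K C) (@quasi_iso_shift K D) Fq.

Hypothesis FP : forall P : bcomplex C, (forall n, @projective (Mod C) (P n)) ->
  @Perf K D (F P).

Lemma Db_tri_Perf (X : Db C) : Perf X -> @Perf K D (Db_tri X).
Proof.
move=> [P [hP [f hf]]]; apply: Perf_iso (FP hP).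
by exists (fmap Db_tri f); exact: iso_fmap.
Qed.

Definition Dsg_tri : trifunctor (Dsg C) (Dsg D) :=
  loc_trifunctor
    (cone_in_shift (loc_shift_stable (shiftW := @quasi_iso_shift K C) (@Kb_shift_stable K C))
       (@Perf_shift K C))
    (cone_in_shift (loc_shift_stable (shiftW := @quasi_iso_shift K D) (@Kb_shift_stable K D))
       (@Perf_shift K D))
    (cone_in_trifunctor Db_tri_Perf).

End DerivedFunctors.

Section DsgNat.
Variables (K : fieldType) (C : kcat K).

Definition Dsg_proj : functor (Kb C) (Dsg C) :=
  fcomp (loc_proj (cone_in (@Perf K C))) (loc_proj (@quasi_iso K C)).

(** Both localizations keep the objects, so applying [loc_nat] twice reduces naturality to morphisms
    of [Kb]. *)
Lemma Dsg_natiso (E : category) (F G : functor (Dsg C) E)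
    (t : forall X : Kb C, mor (F X) (G X)) :
  (forall X, is_iso (t X)) ->
  (forall (X Y : Kb C) (f : mor X Y),
     fmap G (fmap Dsg_proj f) \oc t X =h t Y \oc fmap F (fmap Dsg_proj f)) ->
  inhabited (natiso F G).
Proof.
move=> ti tn.
have nat : forall (X Y : Dsg C) (f : mor X Y), fmap G f \oc t X =h t Y \oc fmap F f.
  apply: (@loc_nat (Db C) (cone_in (@Perf K C)) E F G t).
  exact: (@loc_nat (Kb C) (@quasi_iso K C) E
    (fcomp F (loc_proj (cone_in (@Perf K C)))) (fcomp G (loc_proj (cone_in (@Perf K C)))) t tn).
by constructor; exists t.
Qed.

Lemma Dsg_proj_iso (X Y : Kb C) (f : mor X Y) : @quasi_iso K C X Y f ->
  is_iso (fmap Dsg_proj f).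
Proof. by move=> qf; apply: (iso_fmap (loc_proj _)); exact: loc_hom_iso. Qed.

End DsgNat.

Section DsgComp.
Variables (K : fieldType) (C D : kcat K).
Variables (F : trifunctor (Kb C) (Kb D)) (G : trifunctor (Kb D) (Kb C)).
Hypothesis Fq : forall (X Y : Kb C) (f : mor X Y), quasi_iso f -> quasi_iso (fmap F f).
Hypothesis FP : forall P : bcomplex C, (forall n, @projective (Mod C) (P n)) ->
  @Perf K D (F P).
Hypothesis Gq : forall (X Y : Kb D) (f : mor X Y), quasi_iso f -> quasi_iso (fmap G f).
Hypothesis GP : forall P : bcomplex D, (forall n, @projective (Mod D) (P n)) ->
  @Perf K C (G P).

Let J := Dsg_proj D.
Let FG := fcomp (Dsg_tri Fq FP) (Dsg_tri Gq GP).

Lemma Dsg_comp_natiso (c : natiso (fcomp F G) (fid (Kb D))) :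
  inhabited (natiso FG (fid (Dsg D))).
Proof.
apply: (@Dsg_natiso K D (Dsg D) FG (fid (Dsg D)) (fun X => fmap J (c X))).
  by move=> X; apply: (iso_fmap J); exact: (nt_iso c).
move=> X Y f.
transitivity (fmap J (f \oc c X)); first by symmetry; exact: (fmap_comp J).
rewrite (nt_nat c f); exact: (fmap_comp J).
Qed.

(** In F G X -> Z X <- X the left map is inverted on passing to [Db] and the right one on passing to
    [Dsg]; the composite of the first with the inverse of the second is the natural isomorphism. *)
Lemma Dsg_comp_zigzag (Z : functor (Kb D) (Kb D))
    (c : forall X : Kb D, mor (F (G X)) (Z X)) (i : forall X : Kb D, mor X (Z X)) :
  (forall X, quasi_iso (c X)) ->
  (forall (X Y : Kb D) (f : mor X Y), fmap Z f \oc c X =h c Y \oc fmap F (fmap G f)) ->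
  (forall X, @cone_in (Db D) (@Perf K D) X (Z X) (loc_hom _ (i X))) ->
  (forall (X Y : Kb D) (f : mor X Y), fmap Z f \oc i X =h i Y \oc f) ->
  inhabited (natiso FG (fid (Dsg D))).
Proof.
move=> cq cnat hi inat.
pose j (X : Kb D) : mor (J (Z X)) (J X) := loc_inv (hi X).
have ij X : fmap J (i X) \oc j X =h idc _ by exact: (loc_hom_inv (hi X)).
have jii X : j X \oc fmap J (i X) =h idc _ by exact: (loc_inv_hom (hi X)).
apply: (@Dsg_natiso K D (Dsg D) FG (fid (Dsg D)) (fun X => j X \oc fmap J (c X))).
  move=> X; apply: iso_comp; first by exists (fmap J (i X)); split; [exact: ij | exact: jii].
  by apply: Dsg_proj_iso; exact: cq.
move=> X Y f.
have e1 : fmap J (fmap Z f) \oc fmap J (c X) =h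
    fmap J (c Y) \oc fmap J (fmap F (fmap G f)).
  by rewrite -!fmap_comp cnat.
have e2 : fmap J (fmap Z f) \oc fmap J (i X) =h fmap J (i Y) \oc fmap J f.
  by rewrite -!fmap_comp inat.
have e3 : fmap J f \oc j X =h j Y \oc fmap J (fmap Z f).
  rewrite -[fmap J f]mcomp1l -(jii Y) -(mcompA (j Y)) -e2 -!mcompA ij.
  by rewrite mcomp1r.
transitivity (fmap J f \oc j X \oc fmap J (c X)); first exact: mcompA.
rewrite e3 -mcompA e1; exact: mcompA.
Qed.

End DsgComp.

(** * The two inverse functors and the maps relating their composites to identities *)

Section MainFunctors.
Variables (K : fieldType) (U : kcat K) (M : kmodule U).
Notation L := (one_point_extension M).

Definition ancone_pairing_quasi_iso := @Kb_ancone_quasi_iso K L U _ _ (pairing_an M)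
  (@tensM_af_exact K U M) (@upart_af_exact K U M).

(** On projective terms the pairing is injective, so its cone is quasi-isomorphic to the complex of
    cokernels, whose terms are projective. *)
Lemma ancone_pairing_Perf (P : bcomplex L) : (forall n, @projective (Mod L) (P n)) ->
  @Perf K U (Kb_ancone_tri (pairing_an M) P).
Proof.
move=> hP; apply: (@Perf_iso _ _ _ (af_complex (af_coker (pairing_an M)) P)).
  apply: quasi_iso_Db; apply: (@ancone_coker_quasi_iso _ _ _ _ _ (pairing_an M) P).
  by move=> n; apply: pairing_inj; apply: hP.
by apply: proj_Perf => n; apply: coker_pairing_projective; apply: hP.
Qed.

Definition extend_quasi_iso := @Kb_af_quasi_iso K U L (extend_af M) (@extend_af_exact K U M).

Lemma extend_Perf (P : bcomplex U) : (forall n, @projective (Mod U) (P n)) ->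
  @Perf K L (Kb_af_tri (extend_af M) P).
Proof. by move=> hP; apply: proj_Perf => n; apply: extend_projective; apply: hP. Qed.

Definition Dsg_cone : trifunctor (Dsg L) (Dsg U) :=
  Dsg_tri ancone_pairing_quasi_iso ancone_pairing_Perf.

Definition Dsg_extend : trifunctor (Dsg U) (Dsg L) :=
  Dsg_tri extend_quasi_iso extend_Perf.

Definition ancone_extend_natiso :
  natiso (fcomp (Kb_ancone_tri (pairing_an M)) (Kb_af_tri (extend_af M))) (fid (Kb U)).
Proof.
refine (@NatIso (Kb U) (Kb U)
  (fcomp (Kb_ancone_tri (pairing_an M)) (Kb_af_tri (extend_af M))) (fid (Kb U))
  (ancone_extend M) _ _).
- move=> X Y f; apply: homotopic_eq => n x [a v].
  by symmetry; exact: (upmapE (afmap (extend_af M) (f n)) v).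
- exact: ancone_extend_iso.
Defined.

Lemma compare_map_nat (X Y : Kb L) (f : mor X Y) :
  fmap (Kb_ancone_tri (ptcover_an M)) f \oc (ancone_compare X : @mor (Kb L) _ _) =h
  (ancone_compare Y : @mor (Kb L) _ _) \oc
    fmap (fcomp (Kb_af_tri (extend_af M)) (Kb_ancone_tri (pairing_an M))) f.
Proof.
apply: homotopic_eq => n x [a v].
transitivity (afmap (ptcover_af M) (f (n + 1)) x (tensM_counit (X (n + 1)) x a),
  f n x (upart_counit (X n) x v)); first by [].
by rewrite -tensM_counit_map -upart_counit_map.
Qed.

(** Source and target have the same terms and differentials but are distinct records, hence this
    comparison. *)
Definition id_chmap (X : bcomplex L) : chmap X (af_complex (id_af L) X) :=
  @ChMap K L X (af_complex (id_af L) X) (fun n => modhom_id (X n)) (fun _ _ _ => erefl).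

Lemma id_chmap_iso X : @is_iso (Kb L) _ _ (id_chmap X).
Proof.
have [//|//|g [_ i]] := chmap_inverse_iso (f := id_chmap X) (g := fun n => modhom_id (X n)).
exact: i.
Qed.

Definition ptcover_in (X : Kb L) : mor X (Kb_ancone_tri (ptcover_an M) X) :=
  (cone_in_map (an_chmap (ptcover_an M) X) : @mor (Kb L) _ _) \oc id_chmap X.

Lemma ptcover_in_nat (X Y : Kb L) (f : mor X Y) :
  fmap (Kb_ancone_tri (ptcover_an M)) f \oc ptcover_in X =h ptcover_in Y \oc f.
Proof.
apply: homotopic_eq => n x v.
transitivity (afmap (ptcover_af M) (f (n + 1)) x 0, f n x v); first by [].
by rewrite mh0.
Qed.

End MainFunctors.

Theorem corollary6p6 (K : fieldType) (U : kcat K) (M : kmodule U) :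
  triangulated_equivalent (Dsg (one_point_extension M)) (Dsg U).
Proof.
exists (Dsg_cone M), (Dsg_extend M : functor _ _); split.
  apply: (@Dsg_comp_zigzag K U (one_point_extension M)
    (Kb_af_tri (extend_af M)) (Kb_ancone_tri (pairing_an M))
    (@extend_quasi_iso K U M) (@extend_Perf K U M)
    (@ancone_pairing_quasi_iso K U M) (@ancone_pairing_Perf K U M)
    (Kb_ancone_tri (ptcover_an M)) (@ancone_compare K U M) (@ptcover_in K U M)
    (@ancone_compare_quasi_iso K U M) (@compare_map_nat K U M) _
    (@ptcover_in_nat K U M)) => X.
  (* The source complex of psi has terms [ptcover_af (X n)], projective whatever the modules [X n]
     are. *)
  by apply: cone_in_Perf => [|n]; [exact: id_chmap_iso | exact: ptcover_projective].
exact: Dsg_comp_natiso (ancone_extend_natiso M).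
Qed.
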